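(* Let $0<t_1<t_2<\infty$, $1<\sigma\le 2$, $0<\kappa\le\sigma-1$, and let $q:[t_1,t_2]\to\mathbb{R}$ be continuous. Suppose that the boundary value problem $$\bigl({}^{\mathcal H}\mathfrak{D}^{\sigma}_{t_1+}x\bigr)(t)+\bigl({}^{\mathcal H}\mathfrak{D}^{\kappa}_{t_1+}(qx)\bigr)(t)=0,\quad t_1<t<t_2,\qquad x(t_1)=x(t_2)=0,$$ has a nontrivial (i.e. not identically zero) continuous solution $x:[t_1,t_2]\to\mathbb{R}$. Then $$\int_{t_1}^{t_2}|q(\varsigma)|\,d\varsigma\;\ge\;\frac{\Gamma(\sigma-\kappa)}{\max\{\Omega,\mho\}},$$ where $$\Omega=\frac{X_2^{\sigma-1}\left(\ln\frac{t_2}{t_1}-X_2\right)^{\sigma-\kappa-1}}{\left(\ln\frac{t_2}{t_1}\right)^{\sigma-1}t_1e^{X_2}},\qquad \mho=\frac{\kappa}{\sigma-1}\left(1-\frac{\kappa}{\sigma-1}\right)^{\frac{\sigma-\kappa-1}{\kappa}}\frac1{t_1}\left(\ln\frac{t_2}{t_1}\right)^{\sigma-\kappa-1},$$ $$X_2=\frac12\left(\ln\frac{t_2}{t_1}+2(\sigma-1)-\kappa-\sqrt{\Delta}\right),\qquad \Delta=\left(\ln\frac{t_2}{t_1}-\kappa\right)^2+4(\sigma-1)(\sigma-1-\kappa).$$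
   Context: For $\alpha>0$ the left-sided Hadamard fractional integral of order $\alpha$ is $({}^{\mathcal H}\mathfrak{I}^{\alpha}_{t_1+}x)(t)=\frac1{\Gamma(\alpha)}\int_{t_1}^{t}\left(\ln\frac t\varsigma\right)^{\alpha-1}\frac{x(\varsigma)}{\varsigma}\,d\varsigma$, and ${}^{\mathcal H}\mathfrak{I}^{0}_{t_1+}x=x$. For $n-1<\alpha\le n$, $n\in\mathbb{N}$, the left-sided Hadamard fractional derivative of order $\alpha$ is $({}^{\mathcal H}\mathfrak{D}^{\alpha}_{t_1+}x)(t)=\delta^n({}^{\mathcal H}\mathfrak{I}^{n-\alpha}_{t_1+}x)(t)$ with $\delta=t\frac{d}{dt}$. A continuous solution is a function $x\in C([t_1,t_2],\mathbb{R})$ for which the Hadamard derivatives in the equation, given by these formulas, exist on $(t_1,t_2)$, the equation holds there, and the boundary conditions hold. $\Gamma$ is the Euler Gamma function. In the boundary case $\kappa=\sigma-1$ the convention $0^0=1$ is used. *)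

(* Defs.v *)
From HB Require Import structures.
From mathcomp Require Import all_boot all_order all_algebra.
From mathcomp Require Import all_classical all_reals all_analysis.

Set Implicit Arguments.
Unset Strict Implicit.
Unset Printing Implicit Defensive.

Import Order.TTheory GRing.Theory Num.Theory.
Import numFieldNormedType.Exports.

Local Open Scope classical_set_scope.
Local Open Scope ring_scope.

Section Hadamard.
Context {R : realType}.
Implicit Types (a b alpha sigma kappa : R) (q x : R -> R).

(* Only meaningful for 0 < z, where the integral converges. *)
Definition euler_Gamma (z : R) : R :=
  \int[lebesgue_measure]_(s in `]0, +oo[) (s `^ (z - 1) * expR (- s)).

(* The endpoint s = t, where [powR] returns 0 for a negative exponent instead
   of a singular value, is a null set. *)
Definition hadamard_integral a alpha x (t : R) : R :=
  if alpha == 0 then x t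
  else (euler_Gamma alpha)^-1 *
       \int[lebesgue_measure]_(s in `[a, t]) (ln (t / s) `^ (alpha - 1) * (x s / s)).

Definition hadamard_delta (f : R -> R) : R -> R := fun t => t * derive1 f t.

Definition hadamard_order alpha : nat := `|Num.ceil alpha|%N.

Lemma hadamard_orderP alpha (n : nat) :
  n%:R - 1 < alpha <= n%:R -> hadamard_order alpha = n.
Proof.
move=> h; rewrite /hadamard_order (_ : Num.ceil alpha = n%:Z) //.
by apply: ceil_def; rewrite intrB.
Qed.

Definition hadamard_derivative a alpha x : R -> R :=
  let n := hadamard_order alpha in
  iter n hadamard_delta (hadamard_integral a (n%:R - alpha) x).

(* [derive1] is total, so the existence of the successive derivatives entering
   delta^n is a separate requirement. *)
Definition hadamard_derivable_on (D : set R) a alpha x : Prop :=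
  let n := hadamard_order alpha in
  forall k : nat, (k < n)%N -> forall t, D t ->
    derivable (iter k hadamard_delta (hadamard_integral a (n%:R - alpha) x)) t 1.

(* Functions on [a, b] are represented by total functions of which only the
   values on [a, b] matter. *)
Definition hadamard_bvp_solution a b sigma kappa q x : Prop :=
  [/\ {within `[a, b], continuous x},
      hadamard_derivable_on `]a, b[ a sigma x,
      hadamard_derivable_on `]a, b[ a kappa (fun s => q s * x s),
      forall t, t \in `]a, b[ ->
        hadamard_derivative a sigma x t +
        hadamard_derivative a kappa (fun s => q s * x s) t = 0 &
      x a = 0 /\ x b = 0].

Definition lyap_Delta a b sigma kappa : R :=
  (ln (b / a) - kappa) ^+ 2 + 4 * (sigma - 1) * (sigma - 1 - kappa).

Definition lyap_X2 a b sigma kappa : R :=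
  2^-1 * (ln (b / a) + 2 * (sigma - 1) - kappa -
          Num.sqrt (lyap_Delta a b sigma kappa)).

(* For kappa = sigma - 1 the two definitions below rely on [0 `^ 0 = 1]
   (lemma [powRr0]). *)
Definition lyap_Omega a b sigma kappa : R :=
  let L := ln (b / a) in
  let X2 := lyap_X2 a b sigma kappa in
  (X2 `^ (sigma - 1) * (L - X2) `^ (sigma - kappa - 1)) /
  (L `^ (sigma - 1) * a * expR X2).

Definition lyap_Mho a b sigma kappa : R :=
  kappa / (sigma - 1) *
  (1 - kappa / (sigma - 1)) `^ ((sigma - kappa - 1) / kappa) *
  a^-1 * ln (b / a) `^ (sigma - kappa - 1).

End Hadamard.

(* Main.v *)
Require Import Defs.
From mathcomp Require Import all_boot all_order all_algebra.
From mathcomp Require Import all_classical all_reals all_analysis.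
From mathcomp Require Import measurable_realfun ring lra.
Import Order.TTheory GRing.Theory Num.Theory.
Import numFieldNormedType.Exports.
Set Implicit Arguments.
Unset Strict Implicit.
Unset Printing Implicit Defensive.
Local Open Scope classical_set_scope.
Local Open Scope ring_scope.

(* Idea.  Put L = ln (t2 / t1).  One integration of the equation shows that
   t (I^(2-sigma) x)' + I^(1-kappa) (q x) is constant on (t1, t2); a second one,
   followed by I^(sigma-1) and the semigroup law I^al I^be = I^(al+be), gives
     x = c (ln (t / t1))^(sigma-1) - I^(sigma-kappa) (q x),
   and x t2 = 0 determines c.  So x is the integral of q x against a Green
   kernel which, as sigma - kappa >= 1, is bounded.  Where that kernel is
   positive it is at most its diagonal value, whose maximum is Omega; its
   negative part is at most max_th (th^(sigma-1-kappa) - th^(sigma-1)) times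
   L^(sigma-kappa-1) / t1, which is Mho.  Evaluating at a maximum point of |x|
   concludes.  The semigroup law rests on the Beta-Gamma relation. *)

(** The solution is only continuous, so the equation cannot be solved for [x] by differentiating.
    Instead I^(sigma-1) turns I^(2-sigma) x into I^1 x, the other terms are written as I^1 of
    continuous functions as well, and the fundamental theorem of calculus strips off I^1. The
    derivatives exist on the open interval only; what happens at t1 is supplied by x t1 = 0, which
    makes I^(2-sigma) x tend to 0 there and so excludes a term in (ln (t / t1))^(sigma-2). The
    orders 2 - sigma and 1 - kappa may be 0, where the integral is the identity by definition, so
    the semigroup law has to cover that case. Both maxima are found without differentiating: ln lies
    below its tangents, and the tangent bounds taken at the critical point have exponents that
    cancel. *)

(** * Exponential substitution in integrals *)

Section Substitution.
Context {R : realType}.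
Notation mu := (@lebesgue_measure R).
Implicit Types (s l : R) (u v : nat -> R) (G : R -> R).

Let expl s l (x : R) : R := s * expR (l * x).

Let is_derive_expl s l (x : R) : is_derive x (1 : R) (expl s l) (l * expl s l x).
Proof.
rewrite /expl (_ : l * (s * _) = s *: (expR (l * x) * l)); last first.
  by rewrite /GRing.scale/=; ring.
apply: is_deriveZ.
apply: (@is_derive1_comp _ expR (fun x => l * x) x).
rewrite -[X in is_derive _ _ _ X]mulr1; exact: is_deriveZ.
Qed.

Let continuous_expl s l : continuous (expl s l).
Proof.
by move=> x; apply: differentiable_continuous; apply/derivable1_diffP.
Qed.

Let derive1_expl s l : derive1 (expl s l) = (fun x => l * expl s l x).
Proof.
by apply/funext => x; rewrite derive1E; apply: derive_val.
Qed.

Let expl_lt s l : 0 < s -> 0 < l -> {homo expl s l : x y / x < y}.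
Proof. by move=> s0 l0 x y xy; rewrite /expl ltr_pM2l// ltr_expR ltr_pM2l. Qed.

Lemma integral_expR_substitution s l a b G : 0 < s -> 0 < l -> a <= b ->
  {within `[s * expR (l * a), s * expR (l * b)], continuous G} ->
  (\int[mu]_(x in `[(s * expR (l * a))%R, (s * expR (l * b))%R]) (G x)%:E =
   \int[mu]_(x in `[a, b])
      (G (s * expR (l * x)) * (l * (s * expR (l * x))))%:E)%E.
Proof.
move=> s0 l0 ab cG.
have cd : continuous (fun x => l * expl s l x).
  by move=> x; apply: cvgMr; exact: continuous_expl.
have := @integration_by_substitution_increasing R (expl s l) G a b ab.
rewrite derive1_expl => subst; apply: subst => //.
- by move=> x y _ _; exact: expl_lt.
- by apply/cvg_ex; exists (l * expl s l a); apply: cvg_at_right_filter; exact: cd.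
- by apply/cvg_ex; exists (l * expl s l b); apply: cvg_at_left_filter; exact: cd.
- split.
  + by move=> x _.
  + by apply: cvg_at_right_filter; exact: continuous_expl.
  + by apply: cvg_at_left_filter; exact: continuous_expl.
Qed.

(** The kernels may be singular at the ends of their support, whereas the substitution rule needs
    continuity on a compact interval. Monotone convergence along the intervals [[u n, v n]] bridges
    the gap; [E] is the image of [D] under the substitution. *)
Lemma ge0_integral_expR_substitution s l u v G : 0 < s -> 0 < l ->
  {homo u : m n / (m <= n)%N >-> n <= m} ->
  {homo v : m n / (m <= n)%N >-> m <= n} ->
  (forall n, u n <= v n) ->
  let D := \bigcup_n `[u n, v n]%classic in
  let E := [set x | 0 < x /\ D (ln (x / s) / l)] in
  {in E, continuous G} -> (forall x, E x -> 0 <= G x) ->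
  (\int[mu]_(x in E) (G x)%:E =
   \int[mu]_(x in D) (G (s * expR (l * x)) * (l * (s * expR (l * x))))%:E)%E.
Proof.
move=> s0 l0 nu nv uv D E cG G0.
have lnE x : ln (s * expR (l * x) / s) / l = x.
  rewrite mulrAC divff ?gt_eqF// mul1r expRK mulrAC divff ?gt_eqF// mul1r//.
have Eexp x : D x -> E (s * expR (l * x)).
  by move=> Dx; split; rewrite ?lnE// mulr_gt0// expR_gt0.
have EE : E = \bigcup_n `[s * expR (l * u n), s * expR (l * v n)]%classic.
  apply/seteqP; split=> [x [x0 [n _]]|x [n _]] /=.
    rewrite in_itv/= => /andP[h1 h2]; exists n => //=.
    have xE : x = s * expR (ln (x / s)).
      by rewrite lnK ?posrE ?divr_gt0// mulrCA divff ?gt_eqF// mulr1.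
    rewrite in_itv/= xE !ler_pM2l// !ler_expR.
    by rewrite ![l * _]mulrC -ler_pdivlMr// h1 -ler_pdivrMr.
  rewrite in_itv/= => /andP[h1 h2].
  have x0 : 0 < x by apply: lt_le_trans h1; rewrite mulr_gt0// expR_gt0.
  split => //; exists n => //=.
  have xE : x = s * expR (ln (x / s)).
    by rewrite lnK ?posrE ?divr_gt0// mulrCA divff ?gt_eqF// mulr1.
  move: h1 h2; rewrite {1 2}xE !ler_pM2l// !ler_expR in_itv/=.
  by rewrite ler_pdivlMr// ler_pdivrMr// ![_ * l]mulrC => -> ->.
have cGn n : {within `[s * expR (l * u n), s * expR (l * v n)], continuous G}.
  apply: continuous_in_subspaceT => x; rewrite inE => xn.
  by apply: cG; rewrite inE EE; exists n.
have cGf : {in D, continuous (fun x => G (s * expR (l * x)) * (l * (s * expR (l * x))))}.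
  move=> x; rewrite inE => Dx; apply: cvgM; last first.
    by apply: cvgMr; exact: continuous_expl.
  apply: (@continuous_comp _ _ _ (expl s l) G); first exact: continuous_expl.
  by apply: cG; rewrite inE; exact: Eexp.
have cGfn n : {within `[u n, v n], continuous (fun x => G (s * expR (l * x)) * (l * (s * expR (l * x))))}.
  apply: continuous_in_subspaceT => x; rewrite inE => xn.
  by apply: cGf; rewrite inE; exists n.
have Ecvg : (\int[mu]_(x in `[(s * expR (l * u n))%R, (s * expR (l * v n))%R]) (G x)%:E)%E
   @[n --> \oo] --> (\int[mu]_(x in E) (G x)%:E)%E.
  rewrite EE; apply: ge0_nondecreasing_set_cvg_integral => //.
  - move=> m n mn; rewrite subsetEset; apply: subset_itvScc;
    rewrite bnd_simp ler_pM2l// ler_expR ler_pM2l//.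
      exact: nu.
    exact: nv.
  - by move=> n; apply/measurable_EFinP; exact: subspace_continuous_measurable_fun.
  - by move=> n x xn; rewrite lee_fin G0// EE; exists n.
have Dcvg : (\int[mu]_(x in `[u n, v n]) (G (s * expR (l * x)) * (l * (s * expR (l * x))))%:E)%E
   @[n --> \oo] --> (\int[mu]_(x in D) (G (s * expR (l * x)) * (l * (s * expR (l * x))))%:E)%E.
  apply: ge0_nondecreasing_set_cvg_integral => //.
  - by move=> m n mn; rewrite subsetEset; apply: subset_itvScc; rewrite bnd_simp;
     [exact: nu|exact: nv].
  - by move=> n; apply/measurable_EFinP; exact: subspace_continuous_measurable_fun.
  - move=> n x xn; rewrite lee_fin mulr_ge0// ?mulr_ge0 ?expR_ge0 ?(ltW s0) ?(ltW l0)//.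
    by rewrite G0//; apply: Eexp; exists n.
apply: (cvg_unique _ Ecvg) => //.
apply: cvg_trans Dcvg; apply: near_eq_cvg; near=> n.
exact/esym/integral_expR_substitution.
Unshelve. all: by end_near. Qed.

End Substitution.

(** * The Hadamard kernel and its composition law *)

Section Kernel.
Context {R : realType}.
Notation mu := (@lebesgue_measure R).
Implicit Types (al be s t r : R).

Lemma cvg_powR {T : Type} (F : set_system T) {FF : Filter F} (f : T -> R) (l p : R) :
  0 < l -> f @ F --> l -> (f x) `^ p @[x --> F] --> l `^ p.
Proof.
move=> l0 fl; apply: (@continuous_cvg _ _ _ F FF f (@powR R ^~ p) l _ fl).
by apply/differentiable_continuous/derivable1_diffP/derivable_powR; rewrite in_itv/= l0.
Qed.

Lemma cvg_ln {T : Type} (F : set_system T) {FF : Filter F} (f : T -> R) (l : R) :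
  0 < l -> f @ F --> l -> ln (f x) @[x --> F] --> ln l.
Proof. by move=> l0 fl; apply: (@continuous_cvg _ _ _ F FF f (@ln R) l _ fl);
  exact: continuous_ln. Qed.

(* Extending the kernel by zero lets every Hadamard integral be written over
   the whole line, and makes the operators compose by Fubini on R * R. *)
Definition hkernel al t s : R :=
  if (0 < s) && (s < t) then ln (t / s) `^ (al - 1) / s else 0.

Lemma hkernel_ge0 al t s : 0 <= hkernel al t s.
Proof.
rewrite /hkernel; case: ifPn => // /andP[s0 _].
by rewrite mulr_ge0 ?powR_ge0// invr_ge0 ltW.
Qed.

Lemma measurable_hkernel2 al :
  measurable_fun [set: R * R] (fun z : R * R => hkernel al z.1 z.2).
Proof.
(* Quotients are expressed through ln and exp of single coordinates, so that joint measurability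
   reduces to functions of one variable. *)
rewrite (_ : (fun _ => _) = (fun z : R * R => if (0 < z.2) && (z.2 < z.1)
    then (ln z.1 - ln z.2) `^ (al - 1) * expR (- ln z.2) else 0)); last first.
  apply/funext => -[t s]; rewrite /hkernel/=; case: ifPn => // /andP[s0 st].
  by rewrite ln_div ?posrE ?(lt_trans s0 st)// expRN lnK.
apply: measurable_fun_ifT => //.
  apply: measurable_and; first exact: measurable_fun_ltr.
  exact: measurable_fun_ltr.
apply: measurable_funM.
  apply: (@measurableT_comp _ _ _ _ _ _ (@powR R ^~ (al - 1))) => //.
  by apply: measurable_funB; exact: measurableT_comp.
apply: measurableT_comp => //.
by apply: measurableT_comp => //; exact: measurableT_comp.
Qed.

Lemma measurable_hkernel al t : measurable_fun [set: R] (hkernel al t).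
Proof.
exact: (measurableT_comp (measurable_hkernel2 al) (measurable_pair1 t)).
Qed.

Lemma measurable_hkernel1 al s : measurable_fun [set: R] (hkernel al ^~ s).
Proof.
exact: (measurableT_comp (measurable_hkernel2 al) (measurable_pair2 s)).
Qed.

(** Valued in the extended reals, so that the identities obtained by Tonelli hold for all orders;
    convergence is settled afterwards. *)
Definition beta_integral al be : \bar R :=
  (\int[mu]_(v in `]0%R, 1%R[) ((1 - v) `^ (al - 1) * v `^ (be - 1))%:E)%E.

Definition gamma_integral al : \bar R :=
  (\int[mu]_(s in `]0%R, +oo[) (s `^ (al - 1) * expR (- s))%:E)%E.

(** The shift by 2 gives [wN n <= 2^-1], so the interval from [wN n] to [1 - wN n] is never
    empty. *)
Let wN (n : nat) : R := n.+2%:R^-1.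

Let wN_le : {homo wN : m n / (m <= n)%N >-> n <= m}.
Proof. by move=> m n mn; rewrite /wN lef_pV2 ?posrE// ler_nat !ltnS. Qed.

Let wN_gt0 n : 0 < wN n. Proof. by rewrite invr_gt0. Qed.

Let wN_le2 n : wN n <= 2^-1.
Proof. by rewrite /wN lef_pV2 ?posrE// ler_nat. Qed.

Let wN_lt x : 0 < x -> exists n, wN n < x.
Proof.
move=> x0; have [n _ h] := near_infty_natSinv_lt (PosNum x0).
exists n; apply: le_lt_trans (h n _) => //=.
by rewrite lef_pV2 ?posrE// ler_nat.
Qed.

(** Substitute r = s e^(l v) with l = ln (t / s): then ln (r / s) = l v, ln (t / r) = l (1 - v) and
    dr / r = l dv. The powers of l add up to al + be - 1 and the rest is the Beta integrand. *)
Lemma hkernel_conv al be t s :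
  (\int[mu]_r (hkernel al t r * hkernel be r s)%:E =
   beta_integral al be * (hkernel (al + be) t s)%:E)%E.
Proof.
have [/andP[s0 st]|nst] := boolP ((0 < s) && (s < t)); last first.
  rewrite {3}/hkernel (negbTE nst) mule0; apply: integral0_eq => r _.
  rewrite /hkernel; case: ifPn => [/andP[r0 rt]|]; last by rewrite mul0r.
  case: ifPn => [/andP[s0 sr]|]; last by rewrite mulr0.
  by move: nst; rewrite s0 (lt_trans sr rt).
set l := ln (t / s).
have l0 : 0 < l by rewrite ln_gt0// ltr_pdivlMr// mul1r.
pose u := wN; pose v n := 1 - wN n.
have DE : \bigcup_n `[u n, v n]%classic = `]0, 1[%classic.
  apply/seteqP; split => [x [n _]|x]/=; rewrite !in_itv/=.
    move=> /andP[h1 h2]; rewrite (lt_le_trans _ h1)//= (le_lt_trans h2)//.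
    by rewrite /v ltrBlDr ltrDl.
  move=> /andP[x0 x1]; have /wN_lt[n hn] : 0 < Num.min x (1 - x).
    by rewrite lt_min x0 subr_gt0.
  exists n => //=; rewrite in_itv/= /u /v.
  by move: hn; rewrite lt_min => /andP[/ltW -> h]/=; lra.
pose G r := hkernel al t r * hkernel be r s.
have EE : [set x | 0 < x /\ `]0, 1[%classic (ln (x / s) / l)] = `]s, t[%classic.
  have t0 := lt_trans s0 st.
  apply/seteqP; split => x /=; rewrite !in_itv/=.
    move=> [x0 /andP[h1 h2]].
    move: h1; rewrite pmulr_lgt0 ?invr_gt0// ln_div// subr_gt0 ltr_ln// => ->/=.
    by move: h2; rewrite ltr_pdivrMr// mul1r /l ltr_ln ?posrE ?divr_gt0//
      ltr_pM2r ?invr_gt0.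
  move=> /andP[sx xt]; have x0 := lt_trans s0 sx; split => //.
  rewrite divr_gt0//=; last by rewrite ln_gt0// ltr_pdivlMr// mul1r.
  by rewrite ltr_pdivrMr// mul1r /l ltr_ln ?posrE ?divr_gt0// ltr_pM2r ?invr_gt0.
have := @ge0_integral_expR_substitution R s l u v G s0 l0.
rewrite /= DE EE => /(_ wN_le) H.
have {}H : (\int[mu]_(x in `]s, t[) (G x)%:E =
  \int[mu]_(x in `]0%R, 1%R[) (G (s * expR (l * x)) * (l * (s * expR (l * x))))%:E)%E.
  apply: H.
  - by move=> m n mn; rewrite /v lerB//; exact: wN_le.
  - by move=> n; rewrite /u /v; have := wN_le2 n; lra.
  - move=> x; rewrite inE/= in_itv/= => /andP[sx xt].
    have x0 := lt_trans s0 sx.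
    have h : {near x, (fun r => ln (t / r) `^ (al - 1) / r * (ln (r / s) `^ (be - 1) / s)) =1 G}.
      near=> r; rewrite /G /hkernel.
      have sr : s < r by near: r; exact: lt_nbhsr.
      have rt : r < t by near: r; exact: lt_nbhsl.
      by rewrite (lt_trans s0 sr) sr s0 rt/=.
    rewrite /continuous_at [G x](esym (nbhs_singleton h)).
    apply: cvg_trans (near_eq_cvg h) _.
    have cinv : r^-1 @[r --> x] --> x^-1.
      by apply: cvgV; [rewrite gt_eqF|exact: cvg_id].
    apply: cvgM; (apply: cvgM; last by (exact: cinv || exact: cvg_cst)).
      apply: cvg_powR; first by rewrite ln_gt0// ltr_pdivlMr// mul1r.
      apply: cvg_ln; first by rewrite divr_gt0// (lt_trans s0 st).
      by apply: cvgM; [exact: cvg_cst|exact: cinv].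
    apply: cvg_powR; first by rewrite ln_gt0// ltr_pdivlMr// mul1r.
    apply: cvg_ln; first by rewrite divr_gt0.
    by apply: cvgM; [exact: cvg_id|exact: cvg_cst].
  - by move=> x _; rewrite mulr_ge0// hkernel_ge0.
rewrite [LHS](_ : _ = \int[mu]_(x in `]s, t[) (G x)%:E)%E; last first.
  rewrite [RHS]integral_mkcond; apply: eq_integral => r _.
  rewrite /G patchE mem_setE in_itv/=; case: ifPn => // nr.
  rewrite /hkernel; case: ifPn => [/andP[r0 rt]|]; last by rewrite mul0r.
  case: ifPn => [/andP[_ sr]|]; last by rewrite mulr0.
  by move: nr; rewrite sr rt.
rewrite H muleC -ge0_integralZl_EFin//=; first last.
- exact: hkernel_ge0.
- apply: measurable_funTS; apply/measurable_EFinP; apply: measurable_funM => //.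
  by apply: (@measurableT_comp _ _ _ _ _ _ (@powR R ^~ (al - 1))) => //;
    exact: measurable_funB.
- by move=> x _; rewrite lee_fin mulr_ge0// powR_ge0.
apply: eq_integral => x; rewrite inE/= in_itv/= => /andP[x0 x1].
rewrite /G /hkernel s0 st/=.
have sx : s < s * expR (l * x).
  by rewrite ltr_pMr// expR_gt1 mulr_gt0.
have t0 := lt_trans s0 st.
have tE : t = s * expR l
  by rewrite /l lnK ?posrE ?divr_gt0// mulrCA divff ?gt_eqF// mulr1.
have xt : s * expR (l * x) < t.
  by rewrite [ltRHS]tE ltr_pM2l// ltr_expR gtr_pMr.
rewrite sx xt (lt_trans s0 sx)/=.
have -> : ln (s * expR (l * x) / s) = l * x.
  by rewrite mulrAC divff ?gt_eqF// mul1r expRK.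
have -> : ln (t / (s * expR (l * x))) = l * (1 - x).
  by rewrite [in LHS]tE -mulf_div divff ?gt_eqF// mul1r -expRB expRK mulrBr mulr1.
rewrite !powRM ?(ltW l0) ?(ltW x0) ?subr_ge0 ?(ltW x1)//.
rewrite -EFinM; congr EFin.
have -> : l `^ (al + be - 1) = l `^ (al - 1) * l `^ (be - 1) * l.
  rewrite -[X in _ * X](powRr1 (ltW l0)) -!powRD ?(gt_eqF l0) ?implybT//.
  by congr (_ `^ _); ring.
have := expR_gt0 (l * x).
set e := expR _ => e0.
field.
by rewrite !gt_eqF.
Unshelve. all: by end_near. Qed.

End Kernel.

(** * The Gamma function and the Beta-Gamma relation *)

Section Gamma.
Context {R : realType}.
Notation mu := (@lebesgue_measure R).
Implicit Types (al be s t r : R).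

(* w t = t ^ -2 is an eigenfunction of the transposed operators:
   \int_t hkernel al t s * w t = Gamma(al) * w s.  Evaluating the composition
   of orders al and be on it yields the Beta-Gamma relation. *)
Let w t : R := expR (- 2 * ln t).

Let measurable_w : measurable_fun [set: R] w.
Proof. by apply: measurableT_comp => //; exact: measurable_funM. Qed.

Let wN (n : nat) : R := n.+1%:R^-1.

Lemma gamma_integral_ge0 al : (0 <= gamma_integral al)%E.
Proof.
by apply: integral_ge0 => x _; rewrite lee_fin mulr_ge0 ?powR_ge0 ?expR_ge0.
Qed.

Lemma beta_integral_ge0 al be : (0 <= beta_integral al be)%E.
Proof.
by apply: integral_ge0 => x _; rewrite lee_fin mulr_ge0 ?powR_ge0.
Qed.

Lemma measurable_gamma_integrand al :
  measurable_fun setT (fun s => s `^ (al - 1) * expR (- s)).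
Proof.
apply: measurable_funM => //.
by apply: measurableT_comp => //.
Qed.

(** Under t = s e^x the weight [w] contributes e^(-2x): one factor e^-x cancels the Jacobian, the
    other is the weight of the Gamma integrand. This is where the exponent -2 comes from. *)
Lemma hkernel_gamma al s : 0 < s ->
  (\int[mu]_t (hkernel al t s * w t)%:E = gamma_integral al * (w s)%:E)%E.
Proof.
move=> s0.
pose u := wN; pose v n : R := n.+1%:R.
have DE : \bigcup_n `[u n, v n]%classic = `]0, +oo[%classic :> set R.
  apply/seteqP; split => [x [n _]|x]/=; rewrite !in_itv/= andbT.
    by move=> /andP[h1 h2]; rewrite (lt_le_trans _ h1)//= /u /wN.
  move=> x0; have [n _ hn] := near_infty_natSinv_lt (PosNum x0).
  pose m := Num.bound x; have xm : x < m%:R by rewrite archi_boundP// ltW.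
  exists (maxn n m) => //=; rewrite in_itv/= /u /v /wN; apply/andP; split.
    by apply: le_trans (ltW (hn n _)) => //=;
      rewrite lef_pV2 ?posrE// ler_nat ltnS leq_maxl.
  apply: le_trans (ltW xm) _.
  by rewrite ler_nat ltnW// ltnS leq_maxr.
pose G r := hkernel al r s * w r.
have EE : [set x | 0 < x /\ `]0, +oo[%classic (ln (x / s) / 1)] = `]s, +oo[%classic.
  apply/seteqP; split => x /=; rewrite !in_itv/= !andbT divr1.
    by move=> [x0]; rewrite ln_div// subr_gt0 ltr_ln.
  move=> sx; split; first exact: lt_trans sx.
  by rewrite ln_gt0// ltr_pdivlMr// mul1r.
have := @ge0_integral_expR_substitution R s 1 u v G s0 ltr01.
rewrite /= DE EE => H.
have {}H : (\int[mu]_(x in `]s, +oo[) (G x)%:E =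
  \int[mu]_(x in `]0%R, +oo[) (G (s * expR (1 * x)) * (1 * (s * expR (1 * x))))%:E)%E.
  apply: H.
  - by move=> m n mn; rewrite /u /wN lef_pV2 ?posrE// ler_nat.
  - by move=> m n mn; rewrite /v ler_nat.
  - by move=> n; rewrite /u /wN /v (@le_trans _ _ 1) ?invf_le1// ler1n.
  - move=> x; rewrite inE/= in_itv/= andbT => sx.
    have x0 := lt_trans s0 sx.
    have h : {near x, (fun r => ln (r / s) `^ (al - 1) / s * w r) =1 G}.
      near=> r; rewrite /G /hkernel s0/=.
      by have -> : s < r by near: r; exact: lt_nbhsr.
    rewrite /continuous_at [G x](esym (nbhs_singleton h)).
    apply: cvg_trans (near_eq_cvg h) _.
    apply: cvgM; first apply: cvgM; last 1 first.
    + apply: continuous_cvg; first exact: continuous_expR.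
      by apply: cvgM; [exact: cvg_cst|apply: cvg_ln].
    + apply: cvg_powR; first by rewrite ln_gt0// ltr_pdivlMr// mul1r.
      apply: cvg_ln; first by rewrite divr_gt0.
      by apply: cvgM; [exact: cvg_id|exact: cvg_cst].
    + exact: cvg_cst.
  - by move=> x _; rewrite mulr_ge0 ?hkernel_ge0// expR_ge0.
rewrite [LHS](_ : _ = \int[mu]_(x in `]s, +oo[) (G x)%:E)%E; last first.
  rewrite [RHS]integral_mkcond; apply: eq_integral => r _.
  rewrite /G patchE mem_setE in_itv/= andbT; case: ifPn => // nr.
  by rewrite /hkernel (negbTE nr) andbF mul0r.
rewrite H muleC -ge0_integralZl_EFin//=; first last.
- exact: expR_ge0.
- by apply: measurable_funTS; apply/measurable_EFinP; exact: measurable_gamma_integrand.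
- by move=> x _; rewrite lee_fin mulr_ge0 ?powR_ge0// expR_ge0.
apply: eq_integral => x; rewrite inE/= in_itv/= andbT => x0.
rewrite /G /hkernel s0/= !mul1r.
have sx : s < s * expR x by rewrite ltr_pMr// expR_gt1.
rewrite sx.
have -> : ln (s * expR x / s) = x.
  by rewrite mulrAC divff ?gt_eqF// mul1r expRK.
have -> : w (s * expR x) = w s * (expR x)^-1 * (expR x)^-1.
  rewrite /w lnM ?posrE ?expR_gt0// expRK -!expRN -!expRD; congr expR; ring.
rewrite -EFinM; congr EFin; rewrite expRN.
have := expR_gt0 x; set e := expR _ => e0.
field.
by rewrite !gt_eqF.
Unshelve. all: by end_near. Qed.

Let emul_cancelr (x y : \bar R) r : 0 < r -> (x * r%:E = y * r%:E -> x = y)%E.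
Proof.
move=> r0; have rK : (r%:E * r^-1%:E = 1)%E by rewrite -EFinM divff// gt_eqF.
by move=> /(congr1 (fun z => z * r^-1%:E)%E); rewrite -!muleA rK !mule1.
Qed.

(** Tonelli in both orders, at the base point 1. Both sides might still be infinite here; only the
    positive real [w 1] is cancelled. *)
Lemma beta_integral_gamma_integral al be :
  (beta_integral al be * gamma_integral (al + be) =
    gamma_integral al * gamma_integral be)%E.
Proof.
have wpos : 0 < w 1 by exact: expR_gt0.
pose f (z : R * R) : \bar R := (hkernel al z.2 z.1 * hkernel be z.1 1 * w z.2)%:E.
have f0 z : (0 <= f z)%E by rewrite lee_fin !mulr_ge0 ?hkernel_ge0 ?expR_ge0.
have mf : measurable_fun setT f.
  apply/measurable_EFinP; apply: measurable_funM; last first.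
    exact: measurableT_comp.
  apply: measurable_funM.
    apply: (@measurableT_comp _ _ _ _ _ _ (fun z : R * R => hkernel al z.1 z.2) _
      (fun z : R * R => (z.2, z.1))).
      exact: measurable_hkernel2.
    exact: measurable_fun_pair.
  exact: (measurableT_comp (measurable_hkernel1 be 1)).
have := @fubini_tonelli _ _ _ _ _ mu mu f mf f0.
rewrite /fubini_F /fubini_G.
rewrite [X in X = _ -> _](_ :
  (\int[mu]_x _ = gamma_integral al * gamma_integral be * (w 1)%:E)%E); last first.
  transitivity (\int[mu]_x (gamma_integral al * (hkernel be x 1 * w x)%:E))%E.
    apply: eq_integral => x _; rewrite /fubini_F /f/=.
    transitivity (\int[mu]_y ((hkernel be x 1)%:E * (hkernel al y x * w y)%:E))%E.
      by apply: eq_integral => y _; rewrite -EFinM; congr EFin; ring.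
    rewrite ge0_integralZl_EFin//; first last.
    - exact: hkernel_ge0.
    - by apply/measurable_EFinP/measurable_funM => //; exact: measurable_hkernel1.
    - by move=> y _; rewrite lee_fin mulr_ge0 ?hkernel_ge0 ?expR_ge0.
    have [x0|x0] := ltP 0 x; first by rewrite hkernel_gamma// muleCA.
    by rewrite /hkernel ltr01/= ltNge (le_trans x0 ler01)/= mul0e mul0r mule0.
  rewrite ge0_integralZl//=; last exact: gamma_integral_ge0.
  - by rewrite hkernel_gamma// muleA.
  - by apply/measurable_EFinP/measurable_funM => //; exact: measurable_hkernel1.
  - by move=> y _; rewrite lee_fin mulr_ge0 ?hkernel_ge0 ?expR_ge0.
rewrite [X in _ = X -> _](_ :
  (\int[mu]_y _ = beta_integral al be * gamma_integral (al + be) * (w 1)%:E)%E);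
    last first.
  transitivity (\int[mu]_y (beta_integral al be * (hkernel (al + be) y 1 * w y)%:E))%E.
    apply: eq_integral => y _; rewrite /fubini_G /f/=.
    transitivity (\int[mu]_x ((w y)%:E * (hkernel al y x * hkernel be x 1)%:E))%E.
      by apply: eq_integral => x _; rewrite -EFinM; congr EFin; ring.
    rewrite ge0_integralZl_EFin//; first last.
    - exact: expR_ge0.
    - by apply/measurable_EFinP/measurable_funM => //;
      [exact: measurable_hkernel|exact: measurable_hkernel1].
    - by move=> x _; rewrite lee_fin mulr_ge0 ?hkernel_ge0.
    by rewrite hkernel_conv muleCA -EFinM [w y * _]mulrC.
  rewrite ge0_integralZl//=; last exact: beta_integral_ge0.
  - by rewrite hkernel_gamma// muleA.
  - by apply/measurable_EFinP/measurable_funM => //; exact: measurable_hkernel1.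
  - by move=> y _; rewrite lee_fin mulr_ge0 ?hkernel_ge0 ?expR_ge0.
by move=> /(emul_cancelr wpos) ->.
Qed.

Lemma integral_powR01_lty al : 0 < al ->
  (\int[mu]_(s in `]0%R, 1%R]) (s `^ (al - 1))%:E < +oo)%E.
Proof.
move=> al0; pose u n : R := n.+2%:R^-1.
have u0 n : 0 < u n by rewrite invr_gt0.
have u1 n : u n < 1 by rewrite invf_lt1// ltr1n.
have DE : \bigcup_n `[u n, 1]%classic = `]0, 1]%classic :> set R.
  apply/seteqP; split => [x [n _]|x]/=; rewrite !in_itv/=.
    by move=> /andP[h1 ->]; rewrite (lt_le_trans _ h1).
  move=> /andP[x0 x1]; have [n _ hn] := near_infty_natSinv_lt (PosNum x0).
  exists n => //=; rewrite in_itv/= x1 andbT.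
  by apply: le_trans (ltW (hn n _)) => //=; rewrite lef_pV2 ?posrE// ler_nat.
have cf n : {within `[u n, 1], continuous (fun s : R => s `^ (al - 1))}.
  apply: continuous_in_subspaceT => x; rewrite inE/= in_itv/= => /andP[h _].
  apply: cvg_powR; last exact: cvg_id.
  exact: lt_le_trans h.
have : (\int[mu]_(x in `[u n, 1%R]) (x `^ (al - 1))%:E)%E
   @[n --> \oo] --> (\int[mu]_(x in `]0%R, 1%R]) (x `^ (al - 1))%:E)%E.
  rewrite -DE; apply: ge0_nondecreasing_set_cvg_integral => //.
  - move=> m n mn; rewrite subsetEset; apply: subset_itvScc; rewrite bnd_simp//.
    by rewrite lef_pV2 ?posrE// ler_nat !ltnS.
  - by move=> n; apply/measurable_EFinP; exact: subspace_continuous_measurable_fun.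
  - by move=> n x _; rewrite lee_fin powR_ge0.
move=> h; apply: (@le_lt_trans _ _ (al^-1)%:E); last exact: ltry.
rewrite -(cvg_lim _ h)//; apply: lime_le; first by apply/cvg_ex; eexists; exact: h.
apply: nearW => n.
pose F (x : R) := x `^ al / al.
have dF (x : R) : 0 < x -> is_derive x (1:R) F (x `^ (al - 1)).
  move=> x0; have hd : is_derive x (1:R) (@powR R ^~ al) (al * x `^ (al - 1)).
    apply: DeriveDef; first by apply: derivable_powR; rewrite in_itv/= x0.
    by rewrite -derive1E powR_derive1// in_itv/= x0.
  rewrite (_ : x `^ (al - 1) = al^-1 *: (al * x `^ (al - 1))); last first.
    by rewrite /GRing.scale/= mulrA mulVf ?gt_eqF// mul1r.
  rewrite (_ : F = al^-1 \*: (@powR R ^~ al)); first exact: is_deriveZ.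
  by apply/funext => y; rewrite /F mulrC.
have cF x : 0 < x -> {for x, continuous F}.
  move=> x0; apply: differentiable_continuous; apply/derivable1_diffP.
  by have [] := dF _ x0.
rewrite (@continuous_FTC2 _ _ F)//.
- by rewrite -EFinB lee_fin /F powR1 mul1r gerBl divr_ge0 ?powR_ge0 ?ltW.
- split.
  + move=> x; rewrite in_itv/= => /andP[h1 _].
    by have [] := dF _ (lt_trans (u0 n) h1).
  + by apply: cvg_at_right_filter; exact: cF.
  + by apply: cvg_at_left_filter; exact: cF.
- move=> x; rewrite in_itv/= => /andP[h1 _].
  by rewrite derive1E; have /@derive_val := dF _ (lt_trans (u0 n) h1).
Qed.

Lemma gamma_integral_lty al : 0 < al -> (gamma_integral al < +oo)%E.
Proof.
move=> al0.
pose A : R -> R := (fun s => s `^ (al - 1)) \_ `]0, 1].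
(* From ln y < y at y = s / (2 al): s^al is at most e^(al ln (2 al)) e^(s/2). The final factor 2
   undoes the normalisation of the exponential density of rate 1/2. *)
pose C := expR (al * ln (2 * al)) * 2.
pose B s := C * exponential_pdf 2^-1 s.
have A0 s : 0 <= A s by rewrite /A patchE; case: ifPn => // _; rewrite powR_ge0.
have C0 : 0 <= C by rewrite mulr_ge0// expR_ge0.
have B0 s : 0 <= B s by rewrite mulr_ge0// exponential_pdf_ge0.
have mA : measurable_fun setT A.
  apply/(measurable_restrictT _ _).1 => //. by apply: measurable_funTS;
    exact: measurable_powR.
have mB : measurable_fun setT B.
  by apply: measurable_funM => //; exact: measurable_exponential_pdf.
apply: (@le_lt_trans _ _ (\int[mu]_(s in `]0%R, +oo[) ((A s)%:E + (B s)%:E))%E).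
  apply: ge0_le_integral => //=.
  - by move=> x _; rewrite lee_fin mulr_ge0 ?powR_ge0// expR_ge0.
  - by apply: measurable_funTS; apply/measurable_EFinP;
    exact: measurable_gamma_integrand.
  - by apply: measurable_funTS; apply: emeasurable_funD; exact/measurable_EFinP.
  move=> s; rewrite in_itv/= andbT => s0; rewrite -EFinD lee_fin.
  have [s1|s1] := leP s 1.
    rewrite -[leLHS]addr0 lerD// /A patchE mem_setE in_itv/= s0 s1/=.
    by rewrite ler_piMr ?powR_ge0// expR_le1 lerNl oppr0 ltW.
  rewrite -[leLHS]add0r lerD// /B exponential_pdfE ?(ltW s0)// /C.
  rewrite [leRHS](_ : _ = expR (al * ln (2 * al)) * expR (- 2^-1 * s)); last by field.
  rewrite -expRD /powR (gt_eqF s0) -expRD ler_expR.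
  have h1 : (al - 1) * ln s <= al * ln s.
    by rewrite ler_wpM2r ?ln_ge0 ?(ltW s1)//; lra.
  have a2 : 0 < 2 * al by rewrite mulr_gt0.
  have h2 : al * ln s <= al * ln (2 * al) + s / 2.
    rewrite -[X in _ * ln X <= _](_ : (2 * al) * (s / (2 * al)) = s); last first.
      by rewrite mulrCA divff ?mulr1 ?gt_eqF.
    have s2 : 0 < s / (2 * al) by rewrite divr_gt0.
    rewrite lnM// mulrDr lerD2l (le_trans (ler_wpM2l (ltW al0) (ltW (ln_sublinear s2))))//.
    rewrite le_eqVlt; apply/orP; left; apply/eqP; field.
    by rewrite gt_eqF.
  lra.
rewrite ge0_integralD//=.
- rewrite lte_add_pinfty//.
    apply: (@le_lt_trans _ _ (\int[mu]_(s in `]0%R, 1%R]) (s `^ (al - 1))%:E)%E);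
      last exact: integral_powR01_lty.
    rewrite [leRHS]integral_mkcond [leRHS](_ : _ = \int[mu]_s (A s)%:E)%E.
      by apply: ge0_subset_integral => //=; [exact/measurable_EFinP|move=> x _;
        rewrite lee_fin].
    by apply: eq_integral => x _; rewrite /A !patchE; case: ifPn.
  + apply: (@le_lt_trans _ _ (\int[mu]_s (B s)%:E)%E).
      by apply: ge0_subset_integral => //=; [exact/measurable_EFinP|move=> x _;
        rewrite lee_fin].
    under eq_integral do rewrite /B EFinM.
    rewrite ge0_integralZl_EFin//.
    * by rewrite integral_exponential_pdf// mule1 ltry.
    * by move=> x _; rewrite lee_fin exponential_pdf_ge0.
    * by apply/measurable_EFinP; exact: measurable_exponential_pdf.
- by move=> x _; rewrite lee_fin.
- by apply: measurable_funTS; exact/measurable_EFinP.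
- by move=> x _; rewrite lee_fin.
- by apply: measurable_funTS; exact/measurable_EFinP.
Qed.

(** If the integral were 0, the integrand would vanish almost everywhere on a half-line of infinite
    measure on which it is positive. *)
Lemma gamma_integral_gt0 al : (0 < gamma_integral al)%E.
Proof.
rewrite lt0e gamma_integral_ge0 andbT; apply/eqP => /esym h.
have : (\int[mu]_(s in `]0%R, +oo[) `|(s `^ (al - 1) * expR (- s))%:E| = 0)%E.
  rewrite h; apply: eq_integral => s _.
  by rewrite gee0_abs// lee_fin mulr_ge0 ?powR_ge0// expR_ge0.
move/ae_eq_integral_abs => /(_ _ _)[]//.
  by apply: measurable_funTS; apply/measurable_EFinP; exact: measurable_gamma_integrand.
move=> N [mN N0 hN].
have : (mu `]0%R, +oo[ <= mu N)%E.
  apply: le_measure; rewrite ?inE//.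
  apply: subset_trans hN => x /= x0; rewrite not_implyP; split => //.
  case => /eqP; apply/negP; rewrite mulf_neq0 ?gt_eqF ?expR_gt0// powR_gt0//.
  by move: x0; rewrite in_itv/= andbT.
rewrite N0; apply/negP; rewrite -ltNge lebesgue_measure_itv/=.
by rewrite ltry addye // ltry.
Qed.

Lemma euler_GammaE al : 0 < al -> (euler_Gamma al)%:E = gamma_integral al.
Proof.
move=> al0; rewrite /euler_Gamma /Rintegral fineK// ge0_fin_numE ?gamma_integral_ge0//.
exact: gamma_integral_lty.
Qed.

Lemma euler_Gamma_gt0 al : 0 < al -> 0 < euler_Gamma al.
Proof. by move=> al0; rewrite -lte_fin euler_GammaE// gamma_integral_gt0. Qed.

Lemma euler_Gamma1 : euler_Gamma 1 = 1 :> R.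
Proof.
apply: EFin_inj; rewrite euler_GammaE//
  /gamma_integral -(@integral_exponential_pdf R 1 ltr01).
rewrite integral_itv_obnd_cbnd; last first.
  by apply: measurable_funTS; apply/measurable_EFinP; exact: measurable_gamma_integrand.
rewrite integral_mkcond; apply: eq_integral => x _.
rewrite /exponential_pdf !patchE; case: ifPn => // _.
by rewrite subrr powRr0 !mul1r mulN1r.
Qed.

Lemma beta_integralE al be : 0 < al -> 0 < be ->
  beta_integral al be = (euler_Gamma al * euler_Gamma be / euler_Gamma (al + be))%:E.
Proof.
move=> al0 be0; have ab0 : 0 < al + be by rewrite addr_gt0.
rewrite EFinM EFinM (euler_GammaE al0) (euler_GammaE be0) -beta_integral_gamma_integral -(euler_GammaE ab0) -muleA -EFinM.
by rewrite divff ?mule1// gt_eqF// euler_Gamma_gt0.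
Qed.

End Gamma.

(** * Convolution with the kernel and absolute convergence *)

Section Convolution.
Context {R : realType}.
Notation mu := (@lebesgue_measure R).
Implicit Types (al be ga a t s C : R) (f g : R -> R).

Definition hconv al f t : R := \int[mu]_s (hkernel al t s * f s).

(* A class stable under [hconv al], which raises ga by al. *)
Definition hdominated a ga f := measurable_fun [set: R] f /\
  exists2 C, 0 <= C & forall s, `|f s| <= C * hkernel ga s a.

Lemma measurable_hkernel_mul al t f : measurable_fun [set: R] f ->
  measurable_fun [set: R] (fun s => hkernel al t s * f s).
Proof. by move=> mf; apply: measurable_funM => //; exact: measurable_hkernel. Qed.

(** The majorant is itself a kernel, so [hkernel_conv] evaluates its integral exactly. The one
    estimate serves for convergence and for the domination of [hconv al f] at order al + ga. *)
Lemma hkernel_integral_dom al a ga f C t : 0 <= C ->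
  measurable_fun [set: R] f -> (forall s, `|f s| <= C * hkernel ga s a) ->
  (\int[mu]_s `|(hkernel al t s * f s)%:E| <=
    C%:E * (beta_integral al ga * (hkernel (al + ga) t a)%:E))%E.
Proof.
move=> C0 mf fC; rewrite -hkernel_conv -ge0_integralZl_EFin//; first last.
- by apply/measurable_EFinP/measurable_funM;
  [exact: measurable_hkernel|exact: measurable_hkernel1].
- by move=> s _; rewrite lee_fin mulr_ge0// hkernel_ge0.
apply: ge0_le_integral => //=.
- by apply/measurable_EFinP; apply: measurableT_comp => //;
  exact: measurable_hkernel_mul.
- apply/measurable_EFinP; apply: measurable_funM => //.
  by apply: measurable_funM; [exact: measurable_hkernel|exact: measurable_hkernel1].
- move=> s _; rewrite -EFinM lee_fin normrM (ger0_norm (hkernel_ge0 _ _ _)) mulrCA.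
  by rewrite ler_wpM2l// hkernel_ge0.
Qed.

Lemma hdominated_integrable al a ga f t : 0 < al -> 0 < ga -> hdominated a ga f ->
  mu.-integrable setT (EFin \o (fun s => hkernel al t s * f s)).
Proof.
move=> al0 ga0 [mf [C C0 fC]]; apply/integrableP; split.
  by apply/measurable_EFinP; exact: measurable_hkernel_mul.
apply: le_lt_trans (hkernel_integral_dom _ _ C0 mf fC) _.
by rewrite beta_integralE// -!EFinM ltry.
Qed.

Lemma measurable_hconv al a ga f : 0 < al -> 0 < ga -> hdominated a ga f ->
  measurable_fun [set: R] (hconv al f).
Proof.
move=> al0 ga0 fd; have [mf [C C0 fC]] := fd.
(* Tonelli makes a parametric integral measurable for nonnegative functions; a signed [f] is split
   into its positive and negative parts. *)
have mp (g : R -> R) : measurable_fun setT g -> (forall s, 0 <= g s) ->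
    measurable_fun setT (hconv al g).
  move=> mg g0; apply: (measurableT_comp (@fine_measurable R setT measurableT)).
  apply: (@measurable_fun_fubini_tonelli_F _ _ _ _ _ mu
      (fun z : R * R => (hkernel al z.1 z.2 * g z.2)%:E)).
  + apply/measurable_EFinP; apply: measurable_funM; first exact: measurable_hkernel2.
    exact: measurableT_comp.
  + by move=> z; rewrite lee_fin mulr_ge0// hkernel_ge0.
pose fp s := Num.max (f s) 0; pose fn s := Num.max (- f s) 0.
have mfp : measurable_fun setT fp by exact: measurable_funrpos.
have mfn : measurable_fun setT fn by exact: measurable_funrneg.
have fpd : hdominated a ga fp.
  split=> //; exists C => // s; apply: le_trans _ (fC s).
  by rewrite /fp /Num.max; case: ifP => _; rewrite ?normr0.
have fnd : hdominated a ga fn.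
  split=> //; exists C => // s; apply: le_trans _ (fC s).
  by rewrite /fn /Num.max; case: ifP => _; rewrite ?normr0 ?normrN.
rewrite (_ : hconv al f = (fun t => hconv al fp t - hconv al fn t)).
  apply: measurable_funB; apply: mp => // s.
    by rewrite /fp le_max lexx orbT.
  by rewrite /fn le_max lexx orbT.
apply/funext => t; rewrite /hconv -RintegralB//; first last.
- exact: hdominated_integrable fnd.
- exact: hdominated_integrable fpd.
apply: eq_Rintegral => s _; rewrite -mulrBr; congr (_ * _).
rewrite /fp /fn; case: (leP (f s) 0) => h.
  by rewrite max_l ?oppr_ge0// sub0r opprK.
by rewrite max_r ?oppr_le0 ?(ltW h)// subr0.
Qed.

Lemma hconv_dom al a ga f : 0 < al -> 0 < ga -> hdominated a ga f ->
  hdominated a (al + ga) (hconv al f).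
Proof.
move=> al0 ga0 fd; split; first exact: measurable_hconv fd.
have [mf [C C0 fC]] := fd.
exists (C * fine (beta_integral al ga)) => [|t].
  by rewrite mulr_ge0// fine_ge0// beta_integral_ge0.
rewrite -lee_fin EFin_normr_Rintegral//; last exact: hdominated_integrable fd.
apply: le_trans (le_abse_integral _ _ _) _ => //.
  by apply/measurable_EFinP; exact: measurable_hkernel_mul.
apply: le_trans (hkernel_integral_dom _ _ C0 mf fC) _.
by rewrite beta_integralE//= -!EFinM mulrA.
Qed.

Lemma hconv_hkernel al be a t : 0 < al -> 0 < be ->
  hconv al (hkernel be ^~ a) t = fine (beta_integral al be) * hkernel (al + be) t a.
Proof. by move=> al0 be0; rewrite /hconv /Rintegral hkernel_conv beta_integralE. Qed.

Lemma hconv_hconv al be a ga f t : 0 < al -> 0 < be -> 0 < ga -> hdominated a ga f ->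
  hconv al (hconv be f) t = fine (beta_integral al be) * hconv (al + be) f t.
Proof.
move=> al0 be0 ga0 fd; have [mf [C C0 fC]] := fd.
have ab0 : 0 < al + be by rewrite addr_gt0.
pose F (z : R * R) : \bar R := (hkernel al t z.1 * hkernel be z.1 z.2 * f z.2)%:E.
have mF : measurable_fun setT F.
  apply/measurable_EFinP; apply: measurable_funM; last exact: measurableT_comp.
  apply: measurable_funM; last exact: measurable_hkernel2.
  exact: (measurableT_comp (measurable_hkernel al t)).
have kint y : mu.-integrable setT (fun x => (hkernel al t x * hkernel be x y)%:E).
  apply/integrableP; split.
    by apply/measurable_EFinP/measurable_funM;
      [exact: measurable_hkernel|exact: measurable_hkernel1].
  under eq_integral do rewrite gee0_abs ?lee_fin ?mulr_ge0 ?hkernel_ge0//.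
  by rewrite hkernel_conv beta_integralE// -EFinM ltry.
(* Integrating the absolute value first in the intermediate variable composes the two kernels; what
   remains is a finite multiple of an integral already known to converge. *)
have intF : (mu \x mu)%E.-integrable setT F.
apply/(integrable21ltyP mu mu mF) => /=.
  rewrite (_ : (\int[mu]_y _ =
    \int[mu]_y (beta_integral al be * `|(hkernel (al + be) t y * f y)%:E|))%E).
    rewrite ge0_integralZl//=.
    - apply: lte_mul_pinfty; [exact: beta_integral_ge0|by rewrite beta_integralE|].
      by have /integrableP[] := hdominated_integrable t ab0 ga0 fd.
    - by apply/measurable_EFinP/measurableT_comp => //; exact: measurable_hkernel_mul.
    - exact: beta_integral_ge0.
  apply: eq_integral => y _.
  transitivity (\int[mu]_x (`|f y|%:E * (hkernel al t x * hkernel be x y)%:E))%E.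
    apply: eq_integral => x _; rewrite /F /= -EFinM normrM mulrC; congr (_ * _)%:E.
    by rewrite ger0_norm// mulr_ge0// hkernel_ge0.
  rewrite integralZl// hkernel_conv muleCA; congr (_ * _)%E.
  by rewrite /= -EFinM normrM mulrC (ger0_norm (hkernel_ge0 _ _ _)).
have := Fubini intF; rewrite /F/= => h.
apply: EFin_inj.
transitivity (\int[mu]_x \int[mu]_y (hkernel al t x * hkernel be x y * f y)%:E)%E.
  rewrite /hconv {1}/Rintegral fineK; last first.
    apply: integrable_fin_num => //.
    exact: hdominated_integrable t al0 (addr_gt0 be0 ga0) (hconv_dom be0 ga0 fd).
  apply: eq_integral => x _; rewrite EFinM /Rintegral fineK; last first.
    by apply: integrable_fin_num => //; exact: hdominated_integrable fd.
  rewrite -integralZl//; last exact: hdominated_integrable fd.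
  by apply: eq_integral => y _; rewrite -EFinM mulrA.
rewrite h EFinM /hconv /Rintegral [X in (_ * X)%E]fineK; last first.
  by apply: integrable_fin_num => //; exact: hdominated_integrable fd.
rewrite -integralZl//; last exact: hdominated_integrable fd.
apply: eq_integral => y _.
transitivity (\int[mu]_x ((f y)%:E * (hkernel al t x * hkernel be x y)%:E))%E.
  by apply: eq_integral => x _; rewrite -EFinM mulrC.
rewrite integralZl// hkernel_conv beta_integralE//= -!EFinM; congr EFin; ring.
Qed.
End Convolution.

(** * Integrals of order one and the semigroup law *)

Section UnitOrder.
Context {R : realType}.
Notation mu := (@lebesgue_measure R).
Implicit Types (al be ga a b t s c : R) (f g : R -> R).

(** A sum of functions dominated at different orders need not be dominated at a single one: the
    kernel of smaller order is larger near [a], the other one at infinity. This weaker class is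
    additive and is what the fundamental theorem of calculus requires. *)
Definition hadmissible a g := (forall s, s <= a -> g s = 0) /\
  forall t, mu.-integrable setT (EFin \o (fun s => hkernel 1 t s * g s)).

Lemma hdominated_hadmissible a ga g : 0 < ga -> hdominated a ga g -> hadmissible a g.
Proof.
move=> ga0 gd; split=> [s sa|t]; last exact: hdominated_integrable gd.
have [_ [C _ /(_ s)]] := gd.
by rewrite /hkernel [a < s]ltNge sa andbF mulr0 normr_le0 => /eqP.
Qed.

Lemma hadmissibleD a f g :
  hadmissible a f -> hadmissible a g -> hadmissible a (fun s => f s + g s).
Proof.
move=> [f0 fi] [g0 gi]; split=> [s sa|t]; first by rewrite f0// g0// addr0.
rewrite (_ : _ \o _ = (fun s => (hkernel 1 t s * f s)%:E + (hkernel 1 t s * g s)%:E)%E).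
  exact: (integrableD measurableT (fi t) (gi t)).
by apply/funext => s /=; rewrite mulrDr.
Qed.

Lemma hkernel1E t s : 0 < s -> s < t -> hkernel 1 t s = s^-1.
Proof. by move=> s0 st; rewrite /hkernel s0 st/= subrr powRr0 mul1r. Qed.

Lemma hadmissible_integrable_itv a b g : 0 < a -> hadmissible a g ->
  mu.-integrable `[a, b] (EFin \o (fun s => g s / s)).
Proof.
move=> a0 [g0 gi].
(* [hkernel 1 b] vanishes at s = b; with b + 1 in its place the kernel is s^-1 on the whole closed
   interval. *)
have : mu.-integrable `[a, b] (EFin \o (fun s => hkernel 1 (b + 1) s * g s)).
  exact: integrableS (gi (b + 1)).
apply: eq_integrable => // s; rewrite inE/= in_itv/= => /andP[h1 h2].
rewrite hkernel1E 1?mulrC//; first exact: lt_le_trans h1.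
by rewrite (le_lt_trans h2)// ltrDl.
Qed.

Lemma hconv1E a g t : 0 < a -> hadmissible a g ->
  hconv 1 g t = \int[mu]_(s in `[a, t]) (g s / s).
Proof.
move=> a0 ga; have [g0 gi] := ga.
rewrite -Rintegral_itv_bndo_bndc; last first.
  apply: integrableS (hadmissible_integrable_itv t a0 ga) => //.
  by apply: subset_itvl; rewrite bnd_simp.
rewrite [RHS]Rintegral_mkcond; apply: eq_Rintegral => s _.
rewrite patchE mem_setE in_itv/=; case: ifPn => [/andP[h1 h2]|].
  by rewrite hkernel1E 1?mulrC//; exact: lt_le_trans h1.
rewrite negb_and -!ltNge => /orP[sa|].
  by rewrite g0 ?(ltW sa)// mulr0.
by rewrite /hkernel => /negbTE ->; rewrite andbF mul0r.
Qed.

Lemma hconv1_continuous a b g : 0 < a -> a < b -> hadmissible a g ->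
  {within `[a, b], continuous (hconv 1 g)}.
Proof.
move=> a0 ab ga.
have -> : hconv 1 g = fun t => parameterized_integral mu a t (fun s => g s / s).
  by apply/funext => t; exact: hconv1E.
apply: parameterized_integral_continuous; first exact: ltW.
exact: hadmissible_integrable_itv.
Qed.

(** Injectivity of I^1 on continuous functions: [hconv 1 g] has derivative g t / t at t, and it is
    constant near t. *)
Lemma hconv1_eq0 a b g : 0 < a -> hadmissible a g ->
  {in `]a, b[, continuous g} ->
  (forall t, t \in `]a, b[ -> hconv 1 g t = 0) ->
  forall t, t \in `]a, b[ -> g t = 0.
Proof.
move=> a0 ga cg h t tab; move: (tab); rewrite in_itv/= => /andP[at_ tb].
have t0 := lt_trans a0 at_.
have cgt : {for t, continuous (fun s => g s / s)}.
  apply: cvgM; first exact: cg.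
  by apply: cvgV; [rewrite gt_eqF|exact: cvg_id].
have [_] := continuous_FTC1_closed tb (hadmissible_integrable_itv b a0 ga) at_ cgt.
rewrite (_ : derive1 _ t = 0); last first.
  rewrite derive1E; have -> : 0 = 'D_1 (cst 0 : R -> R) t by rewrite derive_cst.
  apply: near_eq_derive; rewrite ?oner_eq0//.
  near=> s; rewrite -hconv1E// h// in_itv/=; apply/andP; split.
    by near: s; exact: lt_nbhsr.
  by near: s; exact: lt_nbhsl.
move=> /esym/eqP; rewrite mulf_eq0 invr_eq0 (gt_eqF t0) orbF => /eqP//.
Unshelve. all: by end_near. Qed.

Lemma hconvZ al a ga c f t : 0 < al -> 0 < ga -> hdominated a ga f ->
  hconv al (fun s => c * f s) t = c * hconv al f t.
Proof.
move=> al0 ga0 fd; rewrite /hconv -RintegralZl//; last exact: hdominated_integrable fd.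
by apply: eq_Rintegral => s _; rewrite mulrCA.
Qed.

Lemma hconvD al a ga be f g t : 0 < al -> 0 < ga -> 0 < be ->
  hdominated a ga f -> hdominated a be g ->
  hconv al (fun s => f s + g s) t = hconv al f t + hconv al g t.
Proof.
move=> al0 ga0 be0 fd gd; rewrite /hconv -RintegralD//; last 2 first.
- exact: hdominated_integrable fd.
- exact: hdominated_integrable gd.
by apply: eq_Rintegral => s _; rewrite mulrDr.
Qed.

Lemma hconv1D a f g t : hadmissible a f -> hadmissible a g ->
  hconv 1 (fun s => f s + g s) t = hconv 1 f t + hconv 1 g t.
Proof.
move=> [_ fi] [_ gi]; rewrite /hconv -RintegralD//.
by apply: eq_Rintegral => s _; rewrite mulrDr.
Qed.

Lemma hdominatedZ a ga c f : hdominated a ga f -> hdominated a ga (fun s => c * f s).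
Proof.
move=> [mf [C C0 fC]]; split; first exact: measurable_funM.
exists (`|c| * C) => [|s]; first by rewrite mulr_ge0.
by rewrite normrM -mulrA ler_wpM2l.
Qed.

Lemma hdominated_hkernel a ga : hdominated a ga (hkernel ga ^~ a).
Proof.
split; first exact: measurable_hkernel1.
by exists 1 => // s; rewrite mul1r ger0_norm// hkernel_ge0.
Qed.

Definition hintegral al f t : R :=
  if al == 0 then f t else (euler_Gamma al)^-1 * hconv al f t.

Lemma hintegral_dom al a ga f : 0 <= al -> 0 < ga -> hdominated a ga f ->
  hdominated a (al + ga) (hintegral al f).
Proof.
rewrite le_eqVlt => /predU1P[<- ga0|al0 ga0 fd].
  by rewrite add0r (_ : hintegral 0 f = f)//; apply/funext => t;
    rewrite /hintegral eqxx.
rewrite (_ : hintegral al f = fun t => (euler_Gamma al)^-1 * hconv al f t).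
  by apply: hdominatedZ; exact: hconv_dom.
by apply/funext => t; rewrite /hintegral gt_eqF.
Qed.

(** The Beta factor left by composing the kernels is exactly what turns the two normalising Gamma
    factors into one. Order 0 is included because it occurs when sigma = 2 or kappa = 1. *)
Lemma hintegral_hintegral al be a ga f t :
  0 <= al -> 0 <= be -> 0 < ga -> hdominated a ga f ->
  hintegral al (hintegral be f) t = hintegral (al + be) f t.
Proof.
rewrite le_eqVlt => /predU1P[<- be0 ga0 fd|al0].
  by rewrite add0r [LHS]/hintegral eqxx.
rewrite le_eqVlt => /predU1P[<- ga0 fd|be0 ga0 fd].
  rewrite addr0; congr (hintegral _ _ _); apply/funext => s.
  by rewrite /hintegral eqxx.
rewrite (_ : hintegral be f = fun t => (euler_Gamma be)^-1 * hconv be f t); last first.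
  by apply/funext => s; rewrite /hintegral gt_eqF.
rewrite /hintegral !gt_eqF ?addr_gt0//.
rewrite (hconvZ _ _ al0 (addr_gt0 be0 ga0) (hconv_dom be0 ga0 fd)).
rewrite (hconv_hconv _ al0 be0 ga0 fd) beta_integralE//=.
have := euler_Gamma_gt0 al0; have := euler_Gamma_gt0 be0.
have := euler_Gamma_gt0 (addr_gt0 al0 be0).
move: (euler_Gamma _) (euler_Gamma _) (euler_Gamma _) => x y z x0 y0 z0.
by field; rewrite !gt_eqF.
Qed.

Lemma hintegral1 f t : hintegral 1 f t = hconv 1 f t.
Proof. by rewrite /hintegral oner_eq0 euler_Gamma1 invr1 mul1r. Qed.

(** For [1 <= al] one factor I^1 can be split off, and an indefinite integral is continuous. *)
Lemma hintegral_continuous al a b ga f : 0 < a -> a < b -> 1 <= al -> 0 < ga ->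
  hdominated a ga f -> {within `[a, b], continuous (hintegral al f)}.
Proof.
move=> a0 ab al1 ga0 fd; have al0 := lt_le_trans ltr01 al1.
have al10 : 0 <= al - 1 by rewrite subr_ge0.
rewrite (_ : hintegral al f = hconv 1 (hintegral (al - 1) f)); last first.
  by apply/funext => t;
    rewrite -hintegral1 (hintegral_hintegral _ ler01 al10 ga0 fd) [1 + _]addrC subrK.
apply: hconv1_continuous => //; apply:
  hdominated_hadmissible (hintegral_dom al10 ga0 fd).
by rewrite ltr_wpDl.
Qed.

End UnitOrder.

(** * From the Hadamard integrals of the problem to convolutions *)

Section Link.
Context {R : realType}.
Notation mu := (@lebesgue_measure R).
Implicit Types (al be ga a b t s c : R) (f g x : R -> R).

Lemma within_continuous_bounded a b x : a <= b -> {within `[a, b], continuous x} ->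
  exists2 c, c \in `[a, b] & forall t, t \in `[a, b] -> `|x t| <= `|x c|.
Proof.
move=> ab cx; apply: (@EVT_max _ (fun t => `|x t|)) => //.
by move=> t; apply: cvg_norm; exact: cx.
Qed.

(** The cut-off excludes [a] because [hkernel 1 s a] is 0 for s <= a; for s > a it equals a^-1,
    hence the factor [a] in the constant. *)
Lemma patch_hdominated a b x : 0 < a -> a < b -> {within `[a, b], continuous x} ->
  hdominated a 1 (x \_ `]a, b]).
Proof.
move=> a0 ab cx; split.
  apply/(measurable_restrictT _ _).1 => //.
  apply: (@measurable_funS _ _ _ _ `[a, b]) => //.
    by apply: subset_itvr; rewrite bnd_simp.
  exact: subspace_continuous_measurable_fun.
have [c cab xc] := within_continuous_bounded (ltW ab) cx.
exists (`|x c| * a) => [|s]; first by rewrite mulr_ge0// ltW.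
rewrite patchE mem_setE in_itv/=; case: ifPn => [/andP[h1 h2]|_].
  rewrite hkernel1E// mulfK ?gt_eqF//; apply: xc.
  by rewrite in_itv/= h2 ltW.
by rewrite normr0 mulr_ge0 ?hkernel_ge0// mulr_ge0// ltW.
Qed.

Lemma hadamard_integralE a b al x t : 0 < a -> a < b ->
  {within `[a, b], continuous x} -> x a = 0 -> t \in `[a, b] ->
  hadamard_integral a al x t = hintegral al (x \_ `]a, b]) t.
Proof.
move=> a0 ab cx xa; rewrite in_itv/= => /andP[at_ tb].
rewrite /hadamard_integral /hintegral; case: ifPn => _.
  rewrite patchE mem_setE in_itv/= tb andbT lt_neqAle at_ andbT.
  by case: eqVneq => //= <-.
congr (_ * _).
pose h s := ln (t / s) `^ (al - 1) * (x s / s).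
have mh : measurable_fun `[a, t] h.
  have sab : `[a, t] `<=` `[a, b] by apply: subset_itvl; rewrite bnd_simp.
  have minv : measurable_fun `[a, t] (fun s : R => s^-1).
    apply: subspace_continuous_measurable_fun => //.
    apply: continuous_in_subspaceT => s; rewrite inE/= in_itv/= => /andP[h1 _].
    by apply: cvgV; [rewrite gt_eqF// (lt_le_trans a0)|exact: cvg_id].
  apply: measurable_funM.
    apply: (@measurableT_comp _ _ _ _ _ _ (@powR R ^~ (al - 1))) => //.
    by apply: measurableT_comp => //; exact: measurable_funM.
  apply: measurable_funM => //.
  apply: (@measurable_funS _ _ _ _ `[a, b]) => //.
  exact: subspace_continuous_measurable_fun.
rewrite /hconv /Rintegral; congr fine.
rewrite -integral_itv_bndo_bndc; last first.
  apply/measurable_EFinP; apply: (@measurable_funS _ _ _ _ `[a, t]) => //.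
  by apply: subset_itvl; rewrite bnd_simp.
rewrite -integral_itv_obnd_cbnd; last first.
  apply/measurable_EFinP; apply: (@measurable_funS _ _ _ _ `[a, t]) => //.
  by apply: (@subset_trans _ `[a, t[); [apply: subset_itvr|apply: subset_itvl];
    rewrite bnd_simp.
rewrite [LHS]integral_mkcond; apply: eq_integral => s _.
rewrite !patchE !mem_setE !in_itv/= /hkernel.
have [as_|sa] := ltP a s; last by rewrite mulr0.
rewrite (lt_trans a0 as_)/=; case: ifPn => st; last by rewrite mul0r.
by rewrite (le_trans (ltW st) tb); congr EFin; rewrite mulrA mulrAC.
Qed.

Lemma hintegral_eq0 al a f s :
  0 <= al -> hdominated a 1 f -> s <= a -> hintegral al f s = 0.
Proof.
move=> al0 fd; have al1 : 0 < al + 1 by rewrite ltr_wpDl.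
by have [h _] := hdominated_hadmissible al1 (hintegral_dom al0 ltr01 fd); exact: h.
Qed.

(** At positive order, domination gives the bound C (ln (t / a))^al / a; at order 0 this is the
    continuity of [x] together with [x a = 0]. It provides the behaviour at [a], where the equation
    says nothing. *)
Lemma hadamard_integral_cvg al a b x : 0 <= al -> 0 < a -> a < b ->
  {within `[a, b], continuous x} -> x a = 0 ->
  hadamard_integral a al x t @[t --> a^'+] --> (0 : R).
Proof.
move=> al0 a0 ab cx xa; move: al0; rewrite le_eqVlt => /predU1P[<-|al0].
  rewrite [X in X @ _](_ : _ = x); last first.
    by apply/funext => t; rewrite /hadamard_integral eqxx.
  by have [_ + _] := (continuous_within_itvP _ ab).1 cx; rewrite xa.
have xd := patch_hdominated a0 ab cx.
have [_ [C C0 hC]] := hintegral_dom (ltW al0) ltr01 xd.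
have l0 : C * (ln (t / a) `^ al / a) @[t --> a^'+] --> (0 : R).
  rewrite -[X in _ --> X](_ : C * (0 / a) = 0); last by rewrite mul0r mulr0.
  apply: cvgM; first exact: cvg_cst.
  apply: cvgM; last exact: cvg_cst.
  have lna : ln (a / a) = 0 by rewrite divff ?ln1// gt_eqF.
  apply: (@increasing_cvg_at_right_comp _ (fun t => ln (t / a)) (@powR R ^~ al) a +oo%O).
  - by [].
  - move=> u v; rewrite !in_itv/= !andbT => au av uv.
    by rewrite ltr_ln ?posrE ?divr_gt0 ?ltr_pM2r ?invr_gt0// (lt_le_trans a0).
  - apply: cvg_at_right_filter; apply: cvg_ln; first by rewrite divr_gt0.
    by apply: cvgM; [exact: cvg_id|exact: cvg_cst].
  - by rewrite lna; exact: powR_cvg0.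
apply/cvgr0Pnorm_le => e e0.
move/cvgr0Pnorm_le : l0 => /(_ e e0) l0.
near=> t.
have at_ : a < t by near: t; exact: nbhs_right_gt.
rewrite (@hadamard_integralE a b)//; last first.
  rewrite in_itv/= (ltW at_)/=; near: t; exact: nbhs_right_le.
apply: le_trans (hC t) _.
apply: le_trans (ler_norm _) _.
rewrite /hkernel a0 at_/= addrK.
by near: t.
Unshelve. all: by end_near.
Qed.

Lemma derive1_0_cst a b (H : R -> R) : (forall t, t \in `]a, b[ -> is_derive t 1 H 0) ->
  exists c, forall t, t \in `]a, b[ -> H t = c.
Proof.
move=> dH; have [ab|ba] := ltP a b; last first.
  by exists 0 => t; rewrite in_itv/= => /andP[h1 h2]; move: (lt_trans h1 h2);
    rewrite ltNge ba.
have key u v : u \in `]a, b[ -> v \in `]a, b[ -> u < v -> H u = H v.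
  move=> uab vab uv; have sub t : u <= t <= v -> t \in `]a, b[.
    move: uab vab; rewrite !in_itv/= => /andP[h1 h2] /andP[h3 h4] /andP[h5 h6].
    by rewrite (lt_le_trans h1)// (le_lt_trans h6).
  have dHuv (t : R) : t \in `]u, v[ -> is_derive t (1 : R) H 0.
    rewrite in_itv/= => /andP[h1 h2]; apply: dH; apply: sub.
    by rewrite !ltW.
  have cH : {within `[u, v], continuous H}.
    apply: derivable_within_continuous => t; rewrite in_itv/= => h.
    by have [] := dH _ (sub _ h).
  have [t _ /eqP] := MVT uv dHuv cH.
  by rewrite mul0r subr_eq0 => /eqP.
exists (H ((a + b) / 2)) => t tab.
have mab : (a + b) / 2 \in `]a, b[ by rewrite in_itv/= !midf_lt.
have [h|h|->//] := ltgtP t ((a + b) / 2); first exact: key.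
exact/esym/key.
Qed.

End Link.

(** * Reduction of the boundary value problem to an integral equation *)

Section Volterra.
Context {R : realType}.
Notation mu := (@lebesgue_measure R).

Lemma hadamard_order2 (sigma : R) : 1 < sigma <= 2 -> hadamard_order sigma = 2.
Proof. by move=> /andP[h1 h2]; apply: hadamard_orderP; apply/andP; split => //;
  lra. Qed.

Lemma hadamard_order1 (kappa : R) : 0 < kappa <= 1 -> hadamard_order kappa = 1%N.
Proof. by move=> /andP[h1 h2]; apply: hadamard_orderP; apply/andP; split => //;
  lra. Qed.

Context (a b sigma kappa : R) (q x : R -> R) (a0 : 0 < a) (ab : a < b) (hs :
  1 < sigma <= 2)
  (hk : 0 < kappa <= sigma - 1) (cq : {within `[a, b], continuous q})
  (sol : hadamard_bvp_solution a b sigma kappa q x).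

Let cx : {within `[a, b], continuous x}. Proof. by case: sol. Qed.
Let xa : x a = 0. Proof. by case: sol => _ _ _ _ []. Qed.
Let z := fun s => q s * x s.
Let cz : {within `[a, b], continuous z}.
Proof. by move=> t; apply: cvgM; [exact: cq|exact: cx]. Qed.
Let za : z a = 0. Proof. by rewrite /z xa mulr0. Qed.
Let x0 := x \_ `]a, b].
Let z0 := z \_ `]a, b].
Let x0d : hdominated a 1 x0. Proof. exact: patch_hdominated. Qed.
Let z0d : hdominated a 1 z0. Proof. exact: patch_hdominated. Qed.
Let s1 : 0 < sigma - 1. Proof. by case/andP: hs => *; lra. Qed.
Let s2 : 0 <= 2 - sigma. Proof. by case/andP: hs => *; lra. Qed.
Let k1 : 0 <= 1 - kappa. Proof. by case/andP: hs; case/andP: hk => *; lra. Qed.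
Let sk : 1 <= sigma - kappa. Proof. by case/andP: hs; case/andP: hk => *; lra. Qed.

Let F := hadamard_integral a (2 - sigma) x.
Let P := hadamard_integral a (1 - kappa) z.

Let kle1 : 0 < kappa <= 1.
Proof. by case/andP: hs; case/andP: hk => *; apply/andP; split; lra. Qed.

Let first_integral : exists c, forall t, t \in `]a, b[ ->
  derivable F t 1 /\ derivable P t 1 /\ derive1 F t = (c - P t) / t.
Proof.
have [_ dF dP eqn _] := sol.
move: dF dP eqn; rewrite /hadamard_derivable_on /hadamard_derivative.
rewrite (hadamard_order2 hs) (hadamard_order1 kle1) => dF dP eqn.
have dF0 t : t \in `]a, b[ -> derivable F t 1 by move=> tab; exact: (dF 0%N).
have dF1 t : t \in `]a, b[ -> derivable (hadamard_delta F) t 1.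
  by move=> tab; exact: (dF 1%N).
have dP0 t : t \in `]a, b[ -> derivable P t 1 by move=> tab; exact: (dP 0%N).
have dH (t : R) : t \in `]a, b[ ->
    is_derive t (1 : R) (fun t => hadamard_delta F t + P t) 0.
  move=> tab.
  (* The outermost delta of both terms carries the same factor t > 0, which can be cancelled. *)
  have -> : 0 = derive1 (hadamard_delta F) t + derive1 P t.
    have := eqn t tab; rewrite /= {1 3}/hadamard_delta -mulrDr => /esym/eqP.
    rewrite eq_sym mulf_eq0 => /orP[/eqP t0|/eqP ->//].
    by move: tab; rewrite in_itv/= t0 => /andP[/(lt_trans a0)]; rewrite ltxx.
  rewrite !derive1E; have i1 := DeriveDef (dF1 t tab) erefl.
  by have i2 := DeriveDef (dP0 t tab) erefl; exact: is_deriveD.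
have [c hc] := derive1_0_cst dH.
exists c => t tab; split; first exact: dF0.
split; first exact: dP0.
have t0 : 0 < t by move: tab; rewrite in_itv/= => /andP[/(lt_trans a0)].
by rewrite -(hc _ tab) addrK /hadamard_delta mulrC mulKf// gt_eqF.
Qed.

Let FE t : t \in `[a, b] -> F t = hintegral (2 - sigma) x0 t.
Proof. by move=> tab; exact: hadamard_integralE. Qed.

Let PE t : t \in `[a, b] -> P t = hintegral (1 - kappa) z0 t.
Proof. by move=> tab; exact: hadamard_integralE. Qed.

Let aab : a \in `[a, b]. Proof. by rewrite in_itv/= lexx ltW. Qed.
Let Fa : F a = 0. Proof. by rewrite (FE aab) (hintegral_eq0 s2 x0d). Qed.
Let Pa : P a = 0. Proof. by rewrite (PE aab) (hintegral_eq0 k1 z0d). Qed.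

(** Powers of ln (t / a) are kept as kernels based at [a], so that the next integration is again a
    composition of kernels. For t <= a all terms vanish, and an integral taken at T < b sees only
    arguments below T. *)
Let integrated : exists c, forall t, t < b ->
  hintegral (2 - sigma) x0 t = c * hkernel 2 t a + (-1) * hintegral (2 - kappa) z0 t.
Proof.
have [c hc] := first_integral.
exists (c * a * fine (beta_integral 1 1)) => t tb.
have [at_|ta] := ltP a t; last first.
  have k20 : 0 <= 2 - kappa by case/andP: kle1 => *; lra.
  rewrite (hintegral_eq0 s2 x0d ta) (hintegral_eq0 k20 z0d ta).
  by rewrite /hkernel (ltNge a) ta andbF !mulr0 addr0.
have t0 := lt_trans a0 at_.
have sub s : s \in `]a, t[ -> s \in `]a, b[.
  by rewrite !in_itv/= => /andP[-> /lt_trans]; exact.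
have cF s : s \in `]a, b[ -> {for s, continuous F}.
  by move=> /hc[h _]; apply/differentiable_continuous/derivable1_diffP.
have cP s : s \in `]a, b[ -> {for s, continuous P}.
  by move=> /hc[_ [h _]]; apply/differentiable_continuous/derivable1_diffP.
have tab : t \in `]a, b[ by rewrite in_itv/= at_.
pose f s := (c - P s) / s.
have cf s : 0 < s -> {for s, continuous P} -> {for s, continuous f}.
  move=> s0 cPs; apply: cvgM; first by apply: cvgB; [exact: cvg_cst|exact: cPs].
  by apply: cvgV; [rewrite gt_eqF|exact: cvg_id].
have ftc : (\int[mu]_(s in `[a, t]) (f s)%:E = (F t)%:E - (F a)%:E)%E.
  apply: continuous_FTC2 => //.
  - apply/(continuous_within_itvP _ at_); split.
    + move=> s sat; apply: cf; last exact/cP/sub.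
      by move: sat; rewrite in_itv/= => /andP[/(lt_trans a0)].
    + apply: cvgM; last first.
        by apply: cvg_at_right_filter; apply: cvgV; [rewrite gt_eqF|exact: cvg_id].
      apply: cvgB; first exact: cvg_cst.
      by rewrite Pa; exact: (hadamard_integral_cvg k1 a0 ab cz za).
    + by apply: cvg_at_left_filter; apply: cf => //; exact: cP.
  - split.
    + by move=> s /sub/hc[].
    + by rewrite Fa; exact: (hadamard_integral_cvg s2 a0 ab cx xa).
    + by apply: cvg_at_left_filter; exact: cF.
  - by move=> s /sub/hc[_ []].
pose P0 := hintegral (1 - kappa) z0.
have P0d : hdominated a (1 - kappa + 1) P0 by exact: hintegral_dom.
have k2 : 0 < 1 - kappa + 1 by rewrite ltr_wpDl.
(* This is the constant [c] cut off to s > a, where [hkernel 1 s a] equals a^-1. *)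
have Hd : hdominated a 1 (fun s => (c * a) * hkernel 1 s a) by apply: hdominatedZ;
  exact: hdominated_hkernel.
have nPd : hdominated a (1 - kappa + 1) (fun s => -1 * P0 s) by exact: hdominatedZ.
pose g s := (c * a) * hkernel 1 s a + (-1) * P0 s.
have ga : hadmissible a g.
  by apply: hadmissibleD; [exact: hdominated_hadmissible Hd|exact:
    hdominated_hadmissible nPd].
have Fg : F t = hconv 1 g t.
  apply: EFin_inj; rewrite (hconv1E _ a0 ga); move: ftc; rewrite Fa sube0 => <-.
  have ig := hadmissible_integrable_itv t a0 ga.
  rewrite /Rintegral fineK; last by apply: integrable_fin_num.
  have mg : measurable_fun `]a, t] (EFin \o (fun s => g s / s)).
    apply: (@measurable_funS _ _ _ _ `[a, t]) => //.
      by apply: subset_itvr; rewrite bnd_simp.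
    by have /integrableP[] := ig.
  have fg : {in `]a, t]%classic, forall s, (f s)%:E = (g s / s)%:E}.
    move=> s; rewrite inE/= in_itv/= => /andP[as_ st].
    rewrite /f PE; last by rewrite in_itv/= (ltW as_) (le_trans st (ltW tb)).
    rewrite /g hkernel1E// mulfK ?gt_eqF//; congr (_ / _)%:E.
    by rewrite mulN1r.
  rewrite -[LHS]integral_itv_obnd_cbnd; last first.
    by apply: (eq_measurable_fun (EFin \o (fun s => g s / s))) mg => s /fg.
  rewrite -[RHS]integral_itv_obnd_cbnd//.
  exact: eq_integral.
rewrite -FE; last by rewrite in_itv/= !ltW.
rewrite Fg /g (hconvD t ltr01 ltr01 k2 Hd nPd); congr (_ + _).
  rewrite (hconvZ _ _ ltr01 ltr01 (hdominated_hkernel _ _)) hconv_hkernel//; ring.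
rewrite (hconvZ _ _ ltr01 k2 P0d) -hintegral1 (hintegral_hintegral _ ler01 k1 ltr01 z0d).
by congr (_ * hintegral _ _ _); ring.
Qed.

Lemma volterra_equation : exists c, forall t, t \in `]a, b] ->
  x t = c * hkernel sigma t a - hintegral (sigma - kappa) z0 t.
Proof.
have [c hc] := integrated.
have k20 : 0 <= 2 - kappa by case/andP: kle1 => *; lra.
have two0 : 0 < 2 :> R := ltr0Sn _ 1.
have s0 : 0 < sigma by case/andP: hs => *; lra.
have sk0 : 0 <= sigma - kappa by apply: le_trans sk.
have k3 : 0 < 2 - kappa + 1 by rewrite ltr_wpDl.
have sk3 : 0 < sigma - kappa + 1 by rewrite ltr_wpDl.
(* Applying I^(sigma-1) to the multiple [c] of the kernel of order 2 gives [c3] times the kernel of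
   order sigma + 1; division by Beta(1, sigma) rewrites the latter as I^1 of the kernel of order
   sigma. *)
pose c3 := (euler_Gamma (sigma - 1))^-1 * (c * fine (beta_integral (sigma - 1) 2)).
pose d := c3 / fine (beta_integral 1 sigma).
have B0 : fine (beta_integral 1 sigma) != 0.
  rewrite beta_integralE//= mulf_neq0 ?mulf_neq0 ?invr_neq0// gt_eqF//
    euler_Gamma_gt0//.
  by rewrite addr_gt0.
have key T : T < b -> hconv 1 x0 T =
    d * hconv 1 (hkernel sigma ^~ a) T + (-1) * hconv 1 (hintegral (sigma - kappa) z0) T.
  move=> Tb.
  have H2d : hdominated a 2 (fun t => c * hkernel 2 t a) by apply: hdominatedZ;
    exact: hdominated_hkernel.
  have nd : hdominated a (2 - kappa + 1) (hintegral (2 - kappa) z0)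
    by exact: hintegral_dom.
  have nd' : hdominated a (2 - kappa + 1) (fun t => -1 * hintegral (2 - kappa) z0 t) by exact: hdominatedZ.
  transitivity (hintegral (sigma - 1) (hintegral (2 - sigma) x0) T).
    rewrite (hintegral_hintegral _ (ltW s1) s2 ltr01 x0d) -hintegral1;
      congr (hintegral _ _ _); ring.
  transitivity (hintegral (sigma - 1)
      (fun t => c * hkernel 2 t a + (-1) * hintegral (2 - kappa) z0 t) T).
    rewrite /hintegral (gt_eqF s1); congr (_ * _).
    apply: eq_Rintegral => s _; have [sT|Ts] := ltP s T.
      by rewrite -[X in _ * X = _]/(hintegral (2 - sigma) x0 s) hc// (lt_trans sT).
    by rewrite /hkernel [s < T]ltNge Ts andbF !mul0r.
  rewrite {1}/hintegral (gt_eqF s1) (hconvD T s1 two0 k3 H2d nd') mulrDr.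
  congr (_ + _).
    rewrite (hconvZ _ _ s1 two0 (hdominated_hkernel _ _)) (hconv_hkernel _ _ s1 two0).
    rewrite (hconv_hkernel _ _ ltr01 s0) [RHS]mulrA /d divfK// /c3 -!mulrA.
    by congr (_ * (_ * (_ * hkernel _ _ _))); ring.
  rewrite (hconvZ _ _ s1 k3 nd) mulrCA; congr (_ * _).
  have := hintegral_hintegral T (ltW s1) k20 ltr01 z0d.
  rewrite {1}/hintegral (gt_eqF s1) => ->.
  rewrite -hintegral1 (hintegral_hintegral _ ler01 sk0 ltr01 z0d).
  by congr (hintegral _ _ _); ring.
pose h t := (- d) * hkernel sigma t a + hintegral (sigma - kappa) z0 t.
have Hd : hdominated a sigma (fun t => - d * hkernel sigma t a)
  by apply: hdominatedZ; exact: hdominated_hkernel.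
have Nd : hdominated a (sigma - kappa + 1) (hintegral (sigma - kappa) z0)
  by exact: hintegral_dom.
have ha : hadmissible a h by apply: hadmissibleD;
  [exact: hdominated_hadmissible Hd|exact: hdominated_hadmissible Nd].
have Ga : hadmissible a (fun t => x0 t + h t).
  by apply: hadmissibleD => //; exact: hdominated_hadmissible x0d.
have G0 T : T < b -> hconv 1 (fun t => x0 t + h t) T = 0.
  move=> Tb; rewrite (hconv1D _ (hdominated_hadmissible ltr01 x0d) ha).
  rewrite (hconv1D _ (hdominated_hadmissible s0 Hd) (hdominated_hadmissible sk3 Nd)) key//.
  by rewrite (hconvZ _ _ ltr01 s0 (hdominated_hkernel _ _)); ring.
have ch : {within `[a, b], continuous h}.
  (* Writing the kernel of order sigma as a multiple of I^1 of the kernel of order sigma - 1 > 0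
     yields its continuity up to the endpoint [a]. *)
  pose B := fine (beta_integral 1 (sigma - 1)).
  have B1 : B != 0.
    rewrite /B beta_integralE//= mulf_neq0 ?mulf_neq0 ?invr_neq0// gt_eqF//
      euler_Gamma_gt0//.
    by rewrite addr_gt0.
  have -> : h = fun t => (- d / B) * hconv 1 (hkernel (sigma - 1) ^~ a) t +
      hintegral (sigma - kappa) z0 t.
    apply/funext => t; rewrite /h (hconv_hkernel _ _ ltr01 s1) -/B.
    by rewrite [1 + _]addrC subrK mulrA divfK.
  move=> t; apply: cvgD; last exact: (hintegral_continuous a0 ab sk ltr01 z0d).
  apply: cvgM; first exact: cvg_cst.
  exact: (hconv1_continuous a0 ab (hdominated_hadmissible s1 (hdominated_hkernel _ _))).
have cG : {within `[a, b], continuous (fun t => x t + h t)}.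
  by move=> t; apply: cvgD; [exact: cx|exact: ch].
have [cGi _ cGb] := (continuous_within_itvP _ ab).1 cG.
have x0E t : t \in `]a, b] -> x0 t = x t.
  by move=> tab; rewrite /x0 patchE mem_setE tab.
have xin t : t \in `]a, b[ -> x t + h t = 0.
  move=> tab; have oo s : s \in `]a, b[ -> s \in `]a, b].
    by rewrite !in_itv/= => /andP[-> /ltW].
  rewrite -x0E; last exact: oo.
  apply: (hconv1_eq0 a0 Ga) tab => [s sab|s]; last first.
    by rewrite in_itv/= => /andP[_]; exact: G0.
  have e : {near s, (fun t => x t + h t) =1 (fun t => x0 t + h t)}.
    near=> r; rewrite x0E//; apply: oo; near: r; exact: near_in_itvoo.
  rewrite /continuous_at [X in _ --> X](esym (nbhs_singleton e)).
  by apply: cvg_trans (near_eq_cvg e) _; exact: cGi.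
have xb : x b + h b = 0.
  apply: (cvg_unique _ cGb) => //.
  apply: cvg_near_cst; near=> r; apply: xin.
  rewrite in_itv/=; apply/andP; split; near: r;
    [exact: nbhs_left_gt|exact: nbhs_left_lt].
exists d => t tab; have : x t + h t = 0.
  move: tab; rewrite in_itv/= => /andP[at_]; rewrite le_eqVlt => /predU1P[->//|tb].
  by apply: xin; rewrite in_itv/= at_.
by rewrite /h => /eqP; rewrite addr_eq0 => /eqP ->; ring.
Unshelve. all: by end_near.
Qed.

End Volterra.

(** * Inequalities for the Green kernel in logarithmic variables *)

Section GreenBound.
Context {R : realType}.
Implicit Types (p r u s x y L ka X : R).

(** The exponentiated form of ln y <= ln x + (y - x) / x. For a product of powers, such bounds at a
    critical point multiply to the maximum, because their exponents add up to the vanishing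
    first-order term. *)
Lemma powR_le_tangent p x y : 0 <= p -> 0 < x -> 0 < y ->
  y `^ p <= x `^ p * expR (p * ((y - x) / x)).
Proof.
move=> p0 x0 y0; have yx0 : 0 < y / x by rewrite divr_gt0.
have yE : y = x * (y / x) by rewrite mulrCA divff ?mulr1// gt_eqF.
rewrite {1}yE powRM ?(ltW x0) ?(ltW yx0)// ler_wpM2l ?powR_ge0//.
rewrite /powR (gt_eqF yx0) ler_expR ler_wpM2l//.
have -> : (y - x) / x = y / x - 1 by rewrite mulrBl divff// gt_eqF.
have := @le_ln1Dx R (y / x - 1).
by rewrite [1 + _]addrC subrK; apply; rewrite ltrBrDl subrr.
Qed.

(** A ratio z / (x + y) in ]0, 1] is at most its p-th power; the ratios for z = x and z = y sum to
    1. *)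
Lemma powR_subadditive p x y : 0 < p <= 1 -> 0 <= x -> 0 <= y ->
  (x + y) `^ p <= x `^ p + y `^ p.
Proof.
move=> /andP[p0 p1]; rewrite le_eqVlt => /predU1P[<-|x0].
  by move=> y0; rewrite add0r lerDr powR_ge0.
rewrite le_eqVlt => /predU1P[<-|y0]; first by rewrite addr0 lerDl powR_ge0.
have xy0 : 0 < x + y by rewrite addr_gt0.
have key z : 0 < z -> z <= x + y -> z / (x + y) * (x + y) `^ p <= z `^ p.
  move=> z0 zxy; have w0 : 0 < z / (x + y) by rewrite divr_gt0.
  have w1 : z / (x + y) <= 1 by rewrite ler_pdivrMr// mul1r.
  rewrite -[in leRHS](divfK (lt0r_neq0 xy0) z) powRM ?(ltW w0) ?(ltW xy0)//.
  by rewrite ler_wpM2r ?powR_ge0// ger1_powR// w0.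
have := lerD (key x x0 _) (key y y0 _).
rewrite -!mulrDl divff ?gt_eqF// mul1r; apply.
  by rewrite lerDl ltW.
by rewrite lerDr ltW.
Qed.

(** With w = y^ka and rho = (p - ka) / ka the difference is w^rho (1 - w), whose maximiser is w = 1
    - ka / p. The tangent bounds for w^rho and for 1 - w at that point have opposite exponents. *)
Lemma powR_sub_le_max p ka y : 0 < ka <= p -> 0 < y <= 1 ->
  y `^ (p - ka) - y `^ p <= ka / p * (1 - ka / p) `^ ((p - ka) / ka).
Proof.
move=> /andP[k0 kp] /andP[y0 y1]; have p0 := lt_le_trans k0 kp.
have p_neq0 : p != 0 by rewrite gt_eqF.
have k_neq0 : ka != 0 by rewrite gt_eqF.
have kp0 : 0 < ka / p by rewrite divr_gt0.
pose w := y `^ ka; pose rho := (p - ka) / ka.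
have w0 : 0 < w by exact: powR_gt0.
have w1 : w <= 1.
  rewrite -[leRHS](_ : 1 `^ ka = 1); last by rewrite powR1.
  by rewrite ge0_ler_powR ?nnegrE ?(ltW k0) ?(ltW y0) ?ler01.
have rho0 : 0 <= rho by rewrite divr_ge0 ?subr_ge0 ?(ltW k0).
have -> : y `^ (p - ka) = w `^ rho by rewrite -powRrM mulrCA divff ?mulr1.
have -> : y `^ p = w `^ rho * w.
  rewrite -{2}(powRr1 (ltW w0)) -powRD; last by rewrite (gt_eqF w0) implybT.
  rewrite -powRrM; congr (_ `^ _); rewrite /rho; field; exact: k_neq0.
rewrite -{1}(mulr1 (w `^ rho)) -mulrBr -/rho.
move: w1; rewrite le_eqVlt => /predU1P[->|w1].
  by rewrite subrr mulr0 mulr_ge0 ?powR_ge0// ltW.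
(* For ka = p the maximiser is 0 and has no tangent bound; the claim is then 1 - w <= 1, since 0 to
   the power 0 is 1. *)
have [kpE|kp'] := eqVneq ka p.
  rewrite /rho kpE subrr mul0r !powRr0 divff// mul1r mulr1 lerBlDr lerDl.
  exact: ltW.
have ltkp : ka < p by rewrite lt_neqAle kp'.
have ws0 : 0 < 1 - ka / p by rewrite subr_gt0 ltr_pdivrMr// mul1r.
have := powR_le_tangent rho0 ws0 w0.
have wc0 : 0 < 1 - w by rewrite subr_gt0.
have := powR_le_tangent ler01 kp0 wc0.
rewrite !powRr1 ?(ltW wc0) ?(ltW kp0)// => h1 h2.
apply: le_trans (ler_pM (powR_ge0 _ _) (ltW wc0) h2 h1) _.
rewrite mulrACA -expRD [X in expR X](_ : _ = 0); first by rewrite expR0 mulr1 mulrC.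
rewrite /rho; field.
by rewrite k_neq0 p_neq0 subr_eq0 eq_sym.
Qed.

Context (L p ka : R) (L0 : 0 < L) (p01 : 0 < p <= 1) (kap : 0 < ka <= p).
Let r := p - ka.

Let p0 : 0 < p. Proof. by case/andP: p01. Qed.
Let r0 : 0 <= r. Proof. by rewrite /r subr_ge0; case/andP: kap. Qed.

(* In logarithmic variables, with L = ln (b / a) and p = sigma - 1, this is the
   smaller root of s ^ 2 - (L + 2 p - ka) s + p L, i.e. the critical point of
   p ln s + (p - ka) ln (L - s) - s; it equals L only if ka = p. *)
Definition critpt :=
  2^-1 * (L + 2 * p - ka - Num.sqrt ((L - ka) ^+ 2 + 4 * p * (p - ka))).

Let D := (L - ka) ^+ 2 + 4 * p * (p - ka).

Let D0 : 0 <= D.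
Proof. by rewrite addr_ge0 ?sqr_ge0// mulr_ge0// mulr_ge0// ltW. Qed.

Let sqD : Num.sqrt D ^+ 2 = D. Proof. exact: sqr_sqrtr. Qed.

Lemma critpt_gt0 : 0 < critpt.
Proof.
rewrite /critpt -/D mulr_gt0// subr_gt0.
have B0 : 0 < L + 2 * p - ka by move: L0 p0 kap => h1 h2 /andP[h3 h4]; lra.
rewrite -(@ltr_pXn2r _ 2)// ?nnegrE ?sqrtr_ge0 ?(ltW B0)// sqD /D -subr_gt0.
have -> : (L + 2 * p - ka) ^+ 2 - ((L - ka) ^+ 2 + 4 * p * (p - ka)) =
  4 * (p * L) by ring.
by rewrite !mulr_gt0.
Qed.

Lemma critpt_le : critpt <= L.
Proof.
rewrite /critpt -/D ler_pdivrMl// lerBlDr -lerBlDl.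
apply: le_trans (ler_norm _) _.
rewrite -sqrtr_sqr ler_wsqrtr// -subr_ge0.
have -> : D - (L + 2 * p - ka - 2 * L) ^+ 2 = 4 * (L * (p - ka)) by rewrite /D; ring.
by rewrite mulr_ge0// mulr_ge0// ltW.
Qed.

(** The critical equation p / X - r / (L - X) = 1, cleared of denominators so that it also covers X
    = L. *)
Lemma critptE : p * (L - critpt) - r * critpt = critpt * (L - critpt).
Proof.
have := sqD; rewrite /critpt -/D; move: (Num.sqrt D) => S hS.
apply/eqP; rewrite -subr_eq0.
rewrite (_ : _ - _ = 4^-1 * (S ^+ 2 - D)); first by rewrite hS subrr mulr0.
by rewrite /r /D; field.
Qed.

(** The exponents of the tangent bounds for s^p and (L - s)^r at the critical point X sum to s - X
    by [critptE], which the weight e^-s absorbs. *)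
Lemma critpt_max s : 0 < s < L ->
  s `^ p * (L - s) `^ r * expR (- s) <=
  critpt `^ p * (L - critpt) `^ r * expR (- critpt).
Proof.
move=> /andP[s0 sL]; have X0 := critpt_gt0; have Ls0 : 0 < L - s by rewrite subr_gt0.
have h1 := powR_le_tangent (ltW p0) X0 s0.
suff h : s `^ p * (L - s) `^ r <= critpt `^ p * (L - critpt) `^ r * expR (s - critpt).
  apply: le_trans (ler_wpM2r (expR_ge0 _) h) _.
  by rewrite -[leLHS]mulrA -expRD addrAC subrr add0r.
(* If the critical point is [L], then r = 0 and L <= p: s^p e^-s increases up to [L], and the
   tangent bound for s^p alone is enough. *)
have := critpt_le; rewrite le_eqVlt => /predU1P[XL|XL].
  have rE : r = 0.
    have := critptE; rewrite XL subrr !mulr0 sub0r => /eqP.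
    by rewrite oppr_eq0 mulf_eq0 (gt_eqF L0) orbF => /eqP.
  have pL : L <= p.
    have := XL; rewrite /critpt -/D => h.
    have := sqrtr_ge0 D; move: rE h; rewrite /r; move: (Num.sqrt D) => S; lra.
  rewrite rE !powRr0 !mulr1; apply: le_trans h1 _.
  rewrite ler_wpM2l ?powR_ge0// ler_expR XL mulrA ler_pdivrMr// mulrC.
  rewrite -subr_ge0 -mulrBr; apply: mulr_le0.
    by rewrite subr_le0 ltW.
  by rewrite subr_le0.
have LX0 : 0 < L - critpt by rewrite subr_gt0.
have h2 := powR_le_tangent r0 LX0 Ls0.
apply: le_trans (ler_pM (powR_ge0 _ _) (powR_ge0 _ _) h1 h2) _.
rewrite mulrACA -expRD [X in _ * expR X <= _](_ : _ = s - critpt)//.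
have := critptE; move: (critpt) X0 LX0 => X X0 LX0 E.
transitivity ((s - X) * ((p * (L - X) - r * X) / (X * (L - X)))).
  by field; rewrite !gt_eqF.
by rewrite E divff ?mulr1// mulf_neq0// gt_eqF.
Qed.

Let Om := critpt `^ p * (L - critpt) `^ r / (L `^ p * expR critpt).
Let Mh := ka / p * (1 - ka / p) `^ (r / ka) * L `^ r.

(** The upper bound keeps the weight e^-s, which determines the maximiser [critpt]; the lower bound
    replaces it by 1 and (L - s)^r by L^r, leaving a maximum in [th] alone. *)
Lemma green_kernel_le u s : 0 < u <= L -> 0 < s < L ->
  `|(u / L) `^ p * (L - s) `^ r - (if s < u then (u - s) `^ r else 0)| * expR (- s)
  <= Num.max Om Mh.
Proof.
move=> /andP[u0 uL] /[dup] sL' /andP[s0 sL].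
have Ls0 : 0 < L - s by rewrite subr_gt0.
have v0 : 0 < u / L by rewrite divr_gt0.
have v1 : u / L <= 1 by rewrite ler_pdivrMr// mul1r.
have Hs : (s / L) `^ p * (L - s) `^ r * expR (- s) <= Om.
  rewrite powRM ?invr_ge0 ?(ltW L0) ?(ltW s0)// -powR_inv1 ?(ltW L0)//.
  rewrite -powRrM mulN1r powRN.
  rewrite [leLHS](_ : _ = (s `^ p * (L - s) `^ r * expR (- s)) / L `^ p); last by ring.
  rewrite ler_pdivrMr ?powR_gt0//; apply: le_trans (critpt_max sL') _.
  rewrite /Om expRN invfM; rewrite le_eqVlt; apply/orP; left; apply/eqP.
  field; rewrite !gt_eqF ?expR_gt0 ?powR_gt0//.
have upper : ((u / L) `^ p * (L - s) `^ r - (if s < u then (u - s) `^ r else 0)) * expR (- s) <= Om.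
  apply: le_trans _ Hs; rewrite ler_wpM2r ?expR_ge0//.
  case: ifPn => [su|]; last first.
    rewrite -leNgt => us; rewrite subr0 ler_wpM2r ?powR_ge0//.
    by rewrite ge0_ler_powR ?nnegrE ?divr_ge0 ?(ltW p0) ?(ltW s0) ?(ltW u0)
      ?(ltW L0)// ler_pM2r ?invr_gt0.
  have us0 : 0 < u - s by rewrite subr_gt0.
  (* u / L <= s / L + th, so subadditivity of the power p <= 1 applies *)
  set th := (u - s) / (L - s).
  have th0 : 0 < th by rewrite divr_gt0.
  have th1 : th <= 1 by rewrite ler_pdivrMr// mul1r lerD2r.
  have usE : u - s = th * (L - s) by rewrite divfK// gt_eqF.
  rewrite usE (@powRM _ th) ?(ltW th0) ?(ltW Ls0)// -mulrBl ler_wpM2r ?powR_ge0//.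
  rewrite lerBlDr.
  apply: (@le_trans _ _ ((s / L) `^ p + th `^ p)); last first.
    by rewrite lerD2l ger_powR ?th0// /r gerBl; case/andP: kap => /ltW.
  apply: le_trans _ (powR_subadditive p01 _ _);
    rewrite ?divr_ge0 ?(ltW s0) ?(ltW L0) ?(ltW th0) ?(ltW us0) ?(ltW Ls0)//.
  rewrite ge0_ler_powR ?nnegrE ?addr_ge0 ?divr_ge0 ?(ltW u0) ?(ltW p0) ?(ltW L0)
    ?(ltW s0) ?(ltW th0) ?(ltW us0) ?(ltW Ls0)//.
  rewrite ler_pdivrMr// mulrDl divfK ?gt_eqF// -lerBlDl usE ler_pM2l// gerBl.
  exact: ltW.
have lower : - ((u / L) `^ p * (L - s) `^ r - (if s < u then (u - s) `^ r else 0)) * expR (- s) <= Mh.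
  have Mh0 : 0 <= Mh.
    by rewrite /Mh !mulr_ge0 ?powR_ge0 ?invr_ge0 ?(ltW p0)//; case/andP: kap => /ltW.
  have [su|us] := ltP s u; last first.
    apply: le_trans _ Mh0; rewrite subr0 mulNr oppr_le0.
    by rewrite !mulr_ge0 ?powR_ge0 ?expR_ge0.
  have us0 : 0 < u - s by rewrite subr_gt0.
  (* th <= u / L reduces the bound to the maximum of th ^ r - th ^ p *)
  set th := (u - s) / (L - s).
  have th0 : 0 < th by rewrite divr_gt0.
  have th1 : th <= 1 by rewrite ler_pdivrMr// mul1r lerD2r.
  have usE : u - s = th * (L - s) by rewrite divfK// gt_eqF.
  have thv : th <= u / L.
    rewrite /th ler_pdivrMr// mulrAC ler_pdivlMr// -subr_ge0.
    have -> : u * (L - s) - (u - s) * L = s * (L - u) by ring.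
    by rewrite mulr_ge0 ?subr_ge0// ltW.
  have es1 : expR (- s) <= 1 by rewrite expR_le1 oppr_le0 ltW.
  rewrite opprB {1}usE (@powRM _ th) ?(ltW th0) ?(ltW Ls0)// -mulrBl.
  have h1 : th `^ r - (u / L) `^ p <= ka / p * (1 - ka / p) `^ (r / ka).
    have th01 : 0 < th <= 1 by rewrite th0.
    apply: le_trans _ (powR_sub_le_max kap th01).
    by rewrite lerB// ge0_ler_powR ?nnegrE ?(ltW p0) ?(ltW th0) ?(ltW v0).
  have M0 : 0 <= ka / p * (1 - ka / p) `^ (r / ka).
    by rewrite !mulr_ge0 ?powR_ge0 ?invr_ge0 ?(ltW p0)//; case/andP: kap => /ltW.
  apply: (@le_trans _ _ (ka / p * (1 - ka / p) `^ (r / ka) * (L - s) `^ r * expR (- s))).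
    by rewrite ler_wpM2r ?expR_ge0// ler_wpM2r ?powR_ge0.
  rewrite /Mh -[leRHS]mulr1.
  apply: (ler_pM (mulr_ge0 M0 (powR_ge0 _ _)) (expR_ge0 _) _ es1).
  rewrite ler_wpM2l// ge0_ler_powR ?nnegrE ?(ltW L0) ?(ltW Ls0)//.
  by rewrite gerBl ltW.
rewrite le_max; case: (ger0P ((u / L) `^ p * (L - s) `^ r - _)) => _.
  by rewrite upper.
by rewrite lower orbT.
Qed.

End GreenBound.

(** * The Green kernel in the original variables *)

Section GreenKernel.
Context {R : realType}.
Notation mu := (@lebesgue_measure R).

(** With s = a e^v the factor s^-1 of the kernel splits into the weight e^-v and the a^-1 common to
    Omega and Mho. *)
Lemma green_kernel_lyap (a b sigma kappa t s : R) : 0 < a -> a < b ->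
  1 < sigma <= 2 -> 0 < kappa <= sigma - 1 -> t \in `]a, b] -> s \in `]a, b[ ->
  `|hkernel sigma t a / hkernel sigma b a * hkernel (sigma - kappa) b s -
    hkernel (sigma - kappa) t s| <=
  Num.max (lyap_Omega a b sigma kappa) (lyap_Mho a b sigma kappa).
Proof.
move=> a0 ab hs hk; rewrite !in_itv/= => /andP[at_ tb] /andP[as_ sb].
have b0 := lt_trans a0 ab; have t0 := lt_trans a0 at_; have s0 := lt_trans a0 as_.
have rat u v : 0 < u -> 0 < v -> ln (u / v) = ln u - ln v by move=> *; rewrite ln_div.
set L := ln (b / a); set u := ln (t / a); set v := ln (s / a).
have lt_ln x y : 0 < x -> 0 < y -> (ln x < ln y) = (x < y) by move=> *; rewrite ltr_ln.
have L0 : 0 < L by rewrite /L rat// subr_gt0 lt_ln.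
have u0 : 0 < u by rewrite /u rat// subr_gt0 lt_ln.
have v0 : 0 < v by rewrite /v rat// subr_gt0 lt_ln.
have uL : u <= L by rewrite /u /L !rat// lerD2r ler_ln.
have vL : v < L by rewrite /v /L !rat// ltrD2r lt_ln.
have p01 : 0 < sigma - 1 <= 1 by case/andP: hs => *; apply/andP; split; lra.
have u0L : 0 < u <= L by rewrite u0.
have v0L : 0 < v < L by rewrite v0.
have := green_kernel_le L0 p01 hk u0L v0L.
set p := sigma - 1; set r := p - kappa.
have rE : sigma - kappa - 1 = r by rewrite /r /p; ring.
have sE : s = a * expR v
  by rewrite /v lnK ?posrE ?divr_gt0// mulrCA divff ?mulr1// gt_eqF.
have -> : hkernel sigma t a / hkernel sigma b a = (u / L) `^ p.
  rewrite /hkernel a0 at_ ab/= -/u -/L -/p powRM ?(ltW u0) ?invr_ge0 ?(ltW L0)//.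
  rewrite -(powR_inv1 (ltW L0)) -powRrM mulN1r powRN.
  by field; rewrite !gt_eqF ?powR_gt0.
have -> : hkernel (sigma - kappa) b s = (L - v) `^ r / s.
  rewrite /hkernel s0 sb/= rE; congr (_ `^ _ / _).
  by rewrite /L /v !rat//; ring.
have -> : hkernel (sigma - kappa) t s = (if v < u then (u - v) `^ r else 0) / s.
  rewrite /hkernel s0/= rE /u /v [in RHS]rat// [in RHS]rat// ltrD2r lt_ln//.
  case: ifPn => st; last by rewrite mul0r.
  by congr (_ `^ _ / _); rewrite rat//; ring.
rewrite mulrA -mulrBl normrM => h.
have ev0 := expR_gt0 v.
rewrite sE normfV (gtr0_norm (mulr_gt0 a0 ev0)) invfM mulrCA -expRN mulrC.
have -> : lyap_Omega a b sigma kappa =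
    critpt L p kappa `^ p * (L - critpt L p kappa) `^ r /
    (L `^ p * expR (critpt L p kappa)) * a^-1.
  rewrite /lyap_Omega -/L rE -/p (_ : lyap_X2 a b sigma kappa = critpt L p kappa)//.
  have := expR_gt0 (critpt L p kappa); have := powR_gt0 p L0.
  move: (expR _) (L `^ p) => e l l0 e0.
  by field; rewrite !gt_eqF.
have -> : lyap_Mho a b sigma kappa =
    kappa / p * (1 - kappa / p) `^ (r / kappa) * L `^ r * a^-1.
  by rewrite /lyap_Mho -/L rE -/p; ring.
by rewrite -maxr_pMl ?invr_ge0 ?(ltW a0)// ler_wpM2r ?invr_ge0 ?(ltW a0).
Qed.

End GreenKernel.

(** * The Lyapunov-type inequality *)

Theorem theorem8 (R : realType) (t1 t2 sigma kappa : R) (q : R -> R)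
  (ht1 : 0 < t1) (ht12 : t1 < t2)
  (hsigma : 1 < sigma <= 2) (hkappa : 0 < kappa <= sigma - 1)
  (hq : {within `[t1, t2], continuous q})
  (hx : exists x : R -> R,
      hadamard_bvp_solution t1 t2 sigma kappa q x /\
      exists2 t, t \in `[t1, t2] & x t <> 0) :
  \int[lebesgue_measure]_(s in `[t1, t2]) `|q s| >=
    euler_Gamma (sigma - kappa) /
    Num.max (lyap_Omega t1 t2 sigma kappa) (lyap_Mho t1 t2 sigma kappa).
Proof.
pose mu := @lebesgue_measure R.
have [x [sol [t0 t0ab xt0]]] := hx.
have [cx _ _ _ [xa xb]] := sol.
have [d hd] := volterra_equation ht1 ht12 hsigma hkappa hq sol.
set z0 := _ \_ _ in hd.
have cz : {within `[t1, t2], continuous (fun s => q s * x s)}.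
  by move=> t; apply: cvgM; [exact: hq|exact: cx].
have z0d : hdominated t1 1 z0 by exact: patch_hdominated.
have z0E s : z0 s = if s \in `]t1, t2] then q s * x s else 0.
  by rewrite /z0 patchE mem_setE.
set M := Num.max _ _.
have sk1 : 0 < sigma - kappa by case/andP: hsigma => *; case/andP: hkappa => *; lra.
set G := euler_Gamma (sigma - kappa).
have G0 : 0 < G := euler_Gamma_gt0 sk1.
have t20 := lt_trans ht1 ht12.
pose H t s := hkernel (sigma - kappa) t s * z0 s.
have intH t : mu.-integrable setT (EFin \o H t).
  exact: hdominated_integrable t sk1 ltr01 z0d.
have hb0 : hkernel sigma t2 t1 != 0.
  rewrite /hkernel ht1 ht12/= mulf_neq0 ?invr_neq0 ?gt_eqF// powR_gt0// ln_gt0//.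
  by rewrite ltr_pdivlMr// mul1r.
have nHE t : hintegral (sigma - kappa) z0 t = G^-1 * \int[mu]_s H t s.
  by rewrite /hintegral gt_eqF.
have dE : d * hkernel sigma t2 t1 = G^-1 * \int[mu]_s H t2 s.
  rewrite -nHE; apply/eqP; rewrite -subr_eq0; apply/eqP.
  by rewrite -hd// in_itv/= ht12 lexx.
have [c cab xc] := within_continuous_bounded (ltW ht12) cx.
have xc0 : 0 < `|x c|.
  by apply: lt_le_trans (xc _ t0ab); rewrite normr_gt0; apply/eqP.
have cab' : c \in `]t1, t2].
  move: cab; rewrite !in_itv/= => /andP[+ ->]; rewrite andbT le_eqVlt => /predU1P[h|//].
  by rewrite -h xa normr0 ltxx in xc0.
(* [rho] is (ln (c / t1) / ln (t2 / t1))^(sigma - 1); by [dE] it is the weight of the integral at t2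
   once [d] is eliminated. *)
pose rho := hkernel sigma c t1 / hkernel sigma t2 t1.
pose K s := (rho * hkernel (sigma - kappa) t2 s - hkernel (sigma - kappa) c s) * z0 s.
have KE : K = fun s => rho * H t2 s - H c s.
  by apply/funext => s; rewrite /K /H mulrBl mulrA.
have intRH : mu.-integrable setT (EFin \o (fun s => rho * H t2 s)).
  exact: (integrableZl measurableT rho (intH t2)).
have intK : mu.-integrable setT (EFin \o K).
  rewrite KE; exact: (integrableB measurableT intRH (intH c)).
have xcE : x c = G^-1 * \int[mu]_s K s.
  rewrite (hd c cab') (nHE c) KE (RintegralB measurableT intRH (intH c)).
  rewrite (RintegralZl rho measurableT (intH t2)) mulrBr; congr (_ - _).
  by rewrite mulrCA -dE /rho mulrCA divfK// mulrC.
have iq : mu.-integrable `[t1, t2] (EFin \o (fun s => `|q s|)).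
  apply: continuous_compact_integrable; first exact: segment_compact.
  by move=> t; apply: cvg_norm; exact: hq.
have iqp : mu.-integrable setT (EFin \o ((fun s => `|q s|) \_ `[t1, t2])).
  by rewrite -restrict_EFin; apply/integrable_restrict => //; rewrite setTI.
have M0 : 0 <= M.
  have mab : (t1 + t2) / 2 \in `]t1, t2[ by rewrite in_itv/= !midf_lt.
  by apply: le_trans (green_kernel_lyap ht1 ht12 hsigma hkappa cab' mab).
have Kle s : `|K s| <= (M * `|x c|) * ((fun s => `|q s|) \_ `[t1, t2]) s.
  rewrite patchE mem_setE /K z0E !in_itv/=.
  have [t1s|st1] := ltP t1 s; last by rewrite mulr0 normr0 !mulr_ge0//; case: ifP.
  rewrite (ltW t1s)/=; case: ifPn => [st2|_]; last by rewrite mulr0 normr0 mulr0.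
  rewrite normrM normrM -mulrA [`|x c| * _]mulrC.
  have xs : `|x s| <= `|x c| by apply: xc; rewrite in_itv/= (ltW t1s).
  apply: ler_pM => //; last by rewrite ler_wpM2l.
  (* At s = t2 both kernels are 0 by their cut-off, so the bound on the open interval extends to
     this endpoint. *)
  move: st2; rewrite le_eqVlt => /predU1P[->|st2].
    rewrite /hkernel ltxx [t2 < c]ltNge; move: cab; rewrite in_itv/= => /andP[_ ->].
    by rewrite !andbF mulr0 subr0 normr0.
  by apply: green_kernel_lyap => //; rewrite in_itv/= t1s.
set I := \int[mu]_(s in _) _.
have I0 : 0 <= I by apply: Rintegral_ge0.
have h : `|\int[mu]_s K s| <= (M * `|x c|) * I.
  apply: le_trans (le_normr_Rintegral measurableT intK) _.
  rewrite [I]Rintegral_mkcond -(RintegralZl _ measurableT iqp).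
  apply: (le_Rintegral measurableT _ (integrableZl measurableT _ iqp)) => [|s _].
    exact: (integrable_norm intK).
  exact: Kle.
have Gi0 : 0 < G^-1 by rewrite invr_gt0.
have : `|x c| <= G^-1 * ((M * `|x c|) * I).
  by rewrite {1}xcE normrM (gtr0_norm Gi0) (ler_wpM2l (ltW Gi0) h).
rewrite [M * _]mulrC -mulrA mulrCA -[leLHS]mulr1 (ler_pM2l xc0) => h1.
have GMI : G <= M * I by rewrite -[leLHS]mulr1 -ler_pdivlMl.
(* Strict positivity, required for the division, is read off from the inequality itself, since G >
   0. *)
have M1 : 0 < M.
  rewrite lt_neqAle M0 andbT; apply/eqP => Meq.
  by move: GMI; rewrite -Meq mul0r leNgt G0.
by rewrite ler_pdivrMr// mulrC.
Qed.
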